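(* Let $p\in(1,+\infty)$ and let $V\colon\mathbb{R}^2\to\mathbb{R}$ be a $C^1$ positive coercive function with $|\nabla V(x)|\le CV^{3/2}(x)$ for a.e. $x$ and some $C>0$. Let \[ I(u)=\frac12\int_{\mathbb{R}^2}(|\nabla u|^2+V(x)u^2)\,dx-\frac1{p+1}\|u\|_2^2\int_{\mathbb{R}^2}V(x)|u|^{p+1}dx,\qquad u\in H^1_V(\mathbb{R}^2), \] \[ \mathcal N=\Big\{u\in H^1_V(\mathbb{R}^2): u\ne0,\ \int_{\mathbb{R}^2}(|\nabla u|^2+V(x)u^2)\,dx=\frac{p+3}{p+1}\|u\|_2^2\int_{\mathbb{R}^2}V(x)|u|^{p+1}dx\Big\}, \] and $\sigma=\inf_{\mathcal N}I$. If $\{u_n\}_n\subset\mathcal N$ satisfies $I(u_n)\to\sigma$, then, up to a subsequence, there exists $u_0\in H^1_V(\mathbb{R}^2)\setminus\{0\}$ such that $u_n\rightharpoonup u_0$ weakly in $H^1_V(\mathbb{R}^2)$.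
   Context: $H^1_V(\mathbb{R}^2)$ is the completion of $C_0^\infty(\mathbb{R}^2)$ with respect to the norm $\|u\|_V=\left(\int_{\mathbb{R}^2}(|\nabla u|^2+V|u|^2)\,dx\right)^{1/2}$; $\|\cdot\|_2$ is the $L^2$ norm. *)

(* Defs.v *)
From HB Require Import structures.
From mathcomp Require Import all_boot all_order all_algebra.
From mathcomp Require Import all_classical all_reals all_analysis.
Set Implicit Arguments. Unset Strict Implicit. Unset Printing Implicit Defensive.
Import Order.TTheory GRing.Theory Num.Theory numFieldNormedType.Exports.
Local Open Scope classical_set_scope.
Local Open Scope ring_scope.

Section Defs.
Variable R : realType.

Definition leb2 := (@lebesgue_measure R \x @lebesgue_measure R)%E.

Definition e1 : R * R := (1, 0).
Definition e2 : R * R := (0, 1).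

Definition d1 (f : R * R -> R) (x : R * R) : R := derive f x e1.
Definition d2 (f : R * R -> R) (x : R * R) : R := derive f x e2.

Definition eucl (x : R * R) : R := Num.sqrt (x.1 ^+ 2 + x.2 ^+ 2).

Fixpoint iterD (l : seq bool) (f : R * R -> R) : R * R -> R :=
  match l with
  | [::] => f
  | b :: l' => (if b then d1 else d2) (iterD l' f)
  end.

Definition smooth (f : R * R -> R) : Prop :=
  forall l : seq bool, continuous (iterD l f) /\
    forall (b : bool) (x : R * R), derivable (iterD l f) x (if b then e1 else e2).

Definition test_fun (f : R * R -> R) : Prop :=
  smooth f /\ compact (closure [set x | f x != 0]).

Definition C1 (f : R * R -> R) : Prop :=
  (forall x, differentiable f x) /\ continuous (d1 f) /\ continuous (d2 f).

Definition gradnorm (f : R * R -> R) (x : R * R) : R :=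
  Num.sqrt (d1 f x ^+ 2 + d2 f x ^+ 2).

(* An element of H^1_V(R^2) is represented concretely by the function u together
   with its (weak) gradient (g1, g2). *)
Record hv := HV { hv_u : R * R -> R; hv_g1 : R * R -> R; hv_g2 : R * R -> R }.

Definition hv_add (a b : hv) : hv :=
  HV (fun x => hv_u a x + hv_u b x) (fun x => hv_g1 a x + hv_g1 b x)
     (fun x => hv_g2 a x + hv_g2 b x).
Definition hv_scale (k : R) (a : hv) : hv :=
  HV (fun x => k * hv_u a x) (fun x => k * hv_g1 a x) (fun x => k * hv_g2 a x).

Definition dist2_test (V : R * R -> R) (phi : R * R -> R) (w : hv) : \bar R :=
  (\int[leb2]_x (((d1 phi x - hv_g1 w x) ^+ 2 + (d2 phi x - hv_g2 w x) ^+ 2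
                   + V x * (phi x - hv_u w x) ^+ 2)%:E))%E.

(* H^1_V(R^2): completion of C_0^infinity w.r.t. ||.||_V, realized as the set of
   (measurable) limits of test functions in the ||.||_V norm *)
Definition in_HV (V : R * R -> R) (w : hv) : Prop :=
  measurable_fun setT (hv_u w) /\ measurable_fun setT (hv_g1 w) /\
  measurable_fun setT (hv_g2 w) /\
  exists phi : nat -> R * R -> R, (forall k, test_fun (phi k)) /\
    (dist2_test V (phi k) w @[k --> \oo] --> 0%E).

Definition normV2 (V : R * R -> R) (w : hv) : \bar R :=
  (\int[leb2]_x ((hv_g1 w x ^+ 2 + hv_g2 w x ^+ 2 + V x * hv_u w x ^+ 2)%:E))%E.

Definition normV (V : R * R -> R) (w : hv) : R := Num.sqrt (fine (normV2 V w)).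

Definition L2norm2 (w : hv) : \bar R :=
  (\int[leb2]_x ((hv_u w x ^+ 2)%:E))%E.

Definition Vpow (V : R * R -> R) (p : R) (w : hv) : \bar R :=
  (\int[leb2]_x ((V x * powR `|hv_u w x| (p + 1))%:E))%E.

Definition hv_is_zero (w : hv) : Prop :=
  {ae leb2, forall x, hv_u w x = 0}.

Definition Ifun (V : R * R -> R) (p : R) (w : hv) : \bar R :=
  ((2^-1)%:E * normV2 V w - (p + 1)^-1%:E * (L2norm2 w * Vpow V p w))%E.

Definition Nset (V : R * R -> R) (p : R) : set hv :=
  [set w | in_HV V w /\ ~ hv_is_zero w /\
           normV2 V w = (((p + 3) / (p + 1))%:E * (L2norm2 w * Vpow V p w))%E].

Definition sigma (V : R * R -> R) (p : R) : \bar R :=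
  ereal_inf [set Ifun V p w | w in Nset V p].

Definition cont_lin_functional (V : R * R -> R) (L : hv -> R) : Prop :=
  (forall a b (k : R), in_HV V a -> in_HV V b ->
     L (hv_add (hv_scale k a) b) = k * L a + L b) /\
  exists K : R, forall w, in_HV V w -> `|L w| <= K * normV V w.

Definition weak_cvg (V : R * R -> R) (u : nat -> hv) (u0 : hv) : Prop :=
  forall L, cont_lin_functional V L -> L (u n) @[n --> \oo] --> L u0.

End Defs.

(* Main.v *)
From HB Require Import structures.
From mathcomp Require Import all_boot all_order all_algebra.
From mathcomp Require Import all_classical all_reals all_analysis.
From mathcomp Require Import measurable_realfun ring lra.
Require Import Defs.
Set Implicit Arguments.
Unset Strict Implicit.
Unset Printing Implicit Defensive.
Import Order.TTheory GRing.Theory Num.Theory numFieldNormedType.Exports.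
Local Open Scope classical_set_scope.
Local Open Scope ring_scope.

(** On the constraint set, [I] is a positive multiple of the squared norm
    [N = normV2 V u], so a minimising sequence is bounded and has a weakly
    convergent subsequence in the Hilbert space [H^1_V].

    The weak limit does not vanish.  Applying
    [int F^2 <= int |d1 F| * int |d2 F|] to [F = sqrt V * f ^ (k+1)], where the
    gradient condition gives [|grad (sqrt V)| <= (C / 2) * V], bounds
    [int V f^(2k+2)] by the square of [N + int V f^(2k)]; by induction on [k],
    [int V |u|^(p+1) <= A * N] on bounded sets.  The constraint
    [N = c * |u|_2^2 * int V |u|^(p+1)] then yields a positive lower bound for
    [|u|_2].  On the other hand, if the weak limit were zero, the integrals of
    [u n] over all squares would tend to [0]; the Poincare inequality on small
    squares, and the coercivity of [V] outside a large one, would force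
    [|u n|_2] to tend to [0]. *)

(** * Semi-inner products, Riesz representation and weak compactness *)

(** Elements of [hv R] are triples of functions, not classes, so [hv_inner] may vanish on nonzero
    triples. The Hilbert space theory is therefore developed for semi-inner products on a submodule.
    On the constraint set c = (p + 3) / (p + 1), so that I = (1/2 - 1/(p + 3)) N, and the factor
    equals (p + 1) / (2 (p + 3)) > 0. The bound on int V |u|^(p+1) has to be linear in N: only then
    does N cancel from N <= c |u|_2^2 A N. The inequality for F gives a quadratic bound, and it
    becomes linear by spending one factor N on the bound N <= M. The exponent 3/2 is the one for
    which grad (sqrt V) = grad V / (2 sqrt V) is of order V. The derivative of F then contains V
    |f|^(k+1), which is at most V f^2 + V f^(2k), so the induction involves no weight other than V.
    The differential inequalities are proved for test functions. The power bounds reach the whole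
    space through almost everywhere convergence and Fatou's lemma, and the smallness of |u n|_2
    through approximation in norm. *)

Lemma exists_subsequence (P : nat -> nat -> Prop) :
  (forall k N, exists n, (N <= n)%N /\ P k n) ->
  exists phi : nat -> nat, {homo phi : m n / (m < n)%N >-> (m < n)%N} /\
    forall k, P k (phi k).
Proof.
move=> h.
have [g hg] := choice (fun kN : nat * nat => h kN.1 kN.2).
pose phi := fix phi k := if k is k'.+1 then g (k'.+1, (phi k').+1) else g (0, 0)%N.
exists phi; split.
- apply: homo_ltn => [|i]; first by move=> ? ? ?; exact: ltn_trans.
  exact: (hg (i.+1, (phi i).+1)).1.
- by case=> [|k]; [exact: (hg (0, 0)%N).2|exact: (hg (k.+1, (phi k).+1)).2].
Qed.

Lemma increasing_geid (phi : nat -> nat) :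
  {homo phi : m n / (m < n)%N >-> (m < n)%N} -> forall k, (k <= phi k)%N.
Proof.
by move=> h; elim=> // k IH; exact: leq_ltn_trans IH (h _ _ (ltnSn k)).
Qed.

Section semi_inner_product.
Variables (R : realType) (T : lmodType R).
Implicit Types (D S : set T) (B : T -> T -> R) (L : T -> R) (w : nat -> T).

(** The common source of every Cauchy-Schwarz argument below: for abstract semi-inner products, on
    intervals, on squares, and for the approximate Euler-Lagrange equation in the Riesz theorem. *)
Lemma sqr_le_discriminant (a b c : R) : 0 <= a ->
  (forall t, 0 <= t ^+ 2 * a + 2 * t * c + b) -> c ^+ 2 <= a * b.
Proof.
rewrite le_eqVlt => /predU1P[<-|a0] h.
- have [->|c0] := eqVneq c 0; first by rewrite mul0r expr0n.
  (* With a = 0 the polynomial is affine and takes the value -1 at this point. *)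
  have := h (- (b + 1) / (2 * c)).
  have -> : (- (b + 1) / (2 * c)) ^+ 2 * 0 + 2 * (- (b + 1) / (2 * c)) * c + b = -1.
    by field.
  by rewrite ler0N1.
- have := h (- c / a).
  have -> : (- c / a) ^+ 2 * a + 2 * (- c / a) * c + b = (a * b - c ^+ 2) / a.
    by field; rewrite gt_eqF.
  by rewrite pmulr_lge0 ?invr_gt0// subr_ge0.
Qed.

Definition submodule S := S 0 /\ forall k a b, S a -> S b -> S (k *: a + b).

Definition linear_on S L :=
  forall k a b, S a -> S b -> L (k *: a + b) = k * L a + L b.

(** All laws are restricted to [D] because the intended form is an integral, which is bilinear only
    where its integrand is integrable. *)
Definition semi_inner D B :=
  [/\ submodule D, (forall a b, D a -> D b -> B a b = B b a),
    (forall c, D c -> linear_on D (B ^~ c)) & (forall a, D a -> 0 <= B a a)].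

Definition cauchy_for B w := forall e : R, 0 < e ->
  exists N, forall m n, (N <= m)%N -> (N <= n)%N -> B (w m - w n) (w m - w n) <= e.

Definition cvg_for B w l := B (w n - l) (w n - l) @[n --> \oo] --> (0 : R).

(** [S] is kept apart from the domain of [B] because the Riesz theorem is also applied to a closed
    submodule of that domain. *)
Definition complete_for S B := forall w, (forall n, S (w n)) -> cauchy_for B w ->
  exists l, S l /\ cvg_for B w l.

Section theory.
Variables (D : set T) (B : T -> T -> R).
Hypothesis DB : semi_inner D B.

Let D0 : D 0. Proof. by case: DB => -[]. Qed.
Let Dlin k a b : D a -> D b -> D (k *: a + b).
Proof. by case: DB => -[_ h] _ _ _; exact: h. Qed.
Let BC a b : D a -> D b -> B a b = B b a.
Proof. by case: DB => _ h _ _; exact: h. Qed.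
Let Blin k a b c : D a -> D b -> D c -> B (k *: a + b) c = k * B a c + B b c.
Proof. by case: DB => _ _ h _ Da Db Dc; exact: h. Qed.

Lemma semi_inner_ge0 a : D a -> 0 <= B a a.
Proof. by case: DB => _ _ _; exact. Qed.

Lemma submodule_sub S a b : submodule S -> S a -> S b -> S (a - b).
Proof. by move=> [_ h] Sa Sb; rewrite addrC -scaleN1r; exact: h. Qed.

Lemma linear_onB S L a b : linear_on S L -> S a -> S b -> L (a - b) = L a - L b.
Proof.
by move=> h Sa Sb; rewrite addrC -scaleN1r h// mulN1r addrC.
Qed.

Lemma semi_innerBl a b c : D a -> D b -> D c -> B (a - b) c = B a c - B b c.
Proof.
move=> Da Db Dc; apply: (@linear_onB D (B ^~ c)) => //.
by case: DB => _ _ h _; exact: h.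
Qed.

Lemma semi_inner_sqr k a b : D a -> D b ->
  B (k *: a + b) (k *: a + b) = k ^+ 2 * B a a + 2 * k * B a b + B b b.
Proof.
move=> Da Db; have Dab := Dlin k Da Db.
rewrite Blin// (BC Da Dab) (BC Db Dab) !Blin// (BC Db Da); ring.
Qed.

Lemma cauchy_schwarz a b : D a -> D b -> B a b ^+ 2 <= B a a * B b b.
Proof.
move=> Da Db; apply: sqr_le_discriminant => [|t]; first exact: semi_inner_ge0.
by rewrite -semi_inner_sqr//; apply: semi_inner_ge0; exact: Dlin.
Qed.

Lemma cauchy_schwarz_sqrt a b : D a -> D b ->
  `|B a b| <= Num.sqrt (B a a) * Num.sqrt (B b b).
Proof.
move=> Da Db; rewrite -sqrtrM ?semi_inner_ge0// -sqrtr_sqr ler_sqrt.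
  exact: cauchy_schwarz.
by rewrite mulr_ge0// semi_inner_ge0.
Qed.

Lemma cvg_for_inner w l a : (forall n, D (w n)) -> D l -> D a ->
  cvg_for B w l -> B (w n) a @[n --> \oo] --> B l a.
Proof.
move=> Dw Dl Da wl.
have Dwl n : D (w n - l) by apply: submodule_sub => //; case: DB.
apply/subr_cvg0.
have h : (B (w n - l) a) ^+ 2 @[n --> \oo] --> (0 : R).
  apply: (@squeeze_cvgr _ _ _ _ (fun=> 0) (fun n => B (w n - l) (w n - l) * B a a)).
  - by apply: nearW => n; rewrite sqr_ge0 cauchy_schwarz.
  - exact: cvg_cst.
  - rewrite -[X in _ --> X](mul0r (B a a)); apply: cvgM; [exact: wl|exact: cvg_cst].
have h2 : `|B (w n - l) a| @[n --> \oo] --> (0 : R).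
  have h3 : Num.sqrt (B (w n - l) a ^+ 2) @[n --> \oo] --> Num.sqrt (0 : R).
    by apply: continuous_cvg h; exact: sqrt_continuous.
  by move: h3; rewrite sqrtr0; under eq_cvg do rewrite sqrtr_sqr.
apply/norm_cvg0P; apply: cvg_trans h2; apply: near_eq_cvg.
by apply: nearW => n /=; rewrite semi_innerBl.
Qed.

(* The representing vector minimises [B a a - 2 * L a]; the parallelogram
   identity makes every minimising sequence Cauchy. *)
Lemma riesz_representation S L (K : R) : S `<=` D -> submodule S -> complete_for S B ->
  linear_on S L -> (forall a, S a -> `|L a| <= K * Num.sqrt (B a a)) ->
  exists v, S v /\ forall a, S a -> L a = B a v.
Proof.
move=> SD Ssub Scomp Llin Lbd.
have [S0 Slin] := Ssub.
pose J a := B a a - 2 * L a.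
have Jlb a : S a -> - K ^+ 2 <= J a.
  move=> Sa; have := Lbd _ Sa; have := semi_inner_ge0 (SD _ Sa).
  rewrite /J => Q0 /(le_trans (ler_norm _)) hL.
  (* With s = sqrt (B a a), J a >= s^2 - 2 K s >= - K^2. *)
  have := sqr_ge0 (Num.sqrt (B a a) - K).
  rewrite -subr_ge0 => h; rewrite -subr_ge0.
  have := sqr_sqrtr Q0; nra.
have Jinf : has_inf (J @` S).
  split; first by exists (J 0); exists 0.
  by exists (- K ^+ 2) => _ [a Sa <-]; exact: Jlb.
pose d := inf (J @` S).
have dJ a : S a -> d <= J a.
  by move=> Sa; apply: (ge_inf Jinf.2); exists a.
have adh n : exists a, S a /\ J a < d + n.+1%:R^-1.
  have e0 : 0 < n.+1%:R^-1 :> R by rewrite invr_gt0.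
  by have [_ [a Sa <-] h] := inf_adherent e0 Jinf; exists a.
have [w hw] := choice adh.
have Sw n : S (w n) by exact: (hw n).1.
have Dw n : D (w n) by exact: SD.
have JE t a b : S a -> S b ->
    J (t *: a + b) = J b + 2 * t * (B a b - L a) + t ^+ 2 * B a a.
  move=> Sa Sb; rewrite /J semi_inner_sqr ?Llin//; try exact: SD.
  ring.
have wcauchy : cauchy_for B w.
  move=> e e0.
  have [N hN] : exists N : nat, 4 / e < N.+1%:R.
    exists (Num.truncn (4 / e)); exact: truncnS_gt.
  have invr_le_quarter k : (N <= k)%N -> k.+1%:R^-1 <= e / 4 :> R.
    move=> Nk; rewrite -[e / 4]invrK lef_pV2 ?posrE ?invr_gt0 ?divr_gt0// invf_div.
    by rewrite (le_trans (ltW hN))// ler_nat.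
  exists N => m n Nm Nn.
  have Smn : S (w m - w n) by exact: submodule_sub.
  have Jm : J (w m) = J (1 *: (w m - w n) + w n) by rewrite scale1r subrK.
  (* The midpoint of [w m] and [w n] is compared with the infimum: J at the midpoint is (J (w m) + J
     (w n)) / 2 - q / 4, where q is the squared distance. Hence q <= 2 (1/(m+1) + 1/(n+1)) <= e. *)
  have h3 := dJ _ (Slin 2^-1 _ _ Smn (Sw n)).
  have h1 := (hw m).2; have h2 := (hw n).2.
  have hm : m.+1%:R^-1 <= e / 4 by apply: invr_le_quarter Nm.
  have hn : n.+1%:R^-1 <= e / 4 by apply: invr_le_quarter Nn.
  rewrite JE// in h3; rewrite JE// in Jm.
  move: h1 h2 h3 hm hn Jm; move: (m.+1%:R^-1) (n.+1%:R^-1) (J (w m)) (J (w n)).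
  set x := B _ (w n); set q := B _ _; set l := L _.
  rewrite expr1n => y z s t h1 h2 h3 hm hn Jm.
  have e4 : 2^-1 ^+ 2 = 4^-1 :> R by rewrite exprVn -natrX.
  rewrite e4 in h3; lra.
have [v [Sv wv]] := Scomp w Sw wcauchy.
exists v; split => // a Sa.
(* Approximate Euler-Lagrange equation: since [w n] minimises J up to 1/(n+1), the quadratic t^2 B a
   a + 2 t (L a - B a (w n)) + 1/(n+1) is nonnegative for every t. *)
have h n : (L a - B (w n) a) ^+ 2 <= B a a * n.+1%:R^-1.
  apply: sqr_le_discriminant => [|t]; first exact/semi_inner_ge0/SD.
  have := dJ _ (Slin (- t) _ _ Sa (Sw n)); rewrite JE// => h.
  have := (hw n).2; rewrite (BC (Dw n) (SD _ Sa)) => h'.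
  move: h h'; rewrite sqrrN; move: (J (w n)) (B a a) (B a (w n)) (L a) (d).
  move: (n.+1%:R^-1) => i y q x l e h h'; lra.
have c1 : (L a - B (w n) a) ^+ 2 @[n --> \oo] --> (L a - B v a) ^+ 2.
  apply: (continuous_cvg _ (@exprn_continuous R 2 _)).
  apply: cvgB; first exact: cvg_cst.
  by apply: cvg_for_inner => //; exact: SD.
have c2 : B a a * n.+1%:R^-1 @[n --> \oo] --> B a a * 0.
  by apply: cvgMr; exact: cvg_harmonic.
have : (L a - B v a) ^+ 2 <= B a a * 0.
  by apply: ler_cvg_to c1 c2 _; exact: nearW.
rewrite mulr0 => le0; have /eqP : (L a - B v a) ^+ 2 = 0.
  by apply/eqP; rewrite eq_le le0 sqr_ge0.
rewrite sqrf_eq0 subr_eq0 => /eqP ->.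
by apply: BC; exact: SD.
Qed.

End theory.

(* A cluster point of the sequence of rows in the compact product of intervals
   replaces the diagonal extraction. *)
Lemma subsequence_rows_cvg (a : nat -> nat -> R) (M : nat -> R) :
  (forall n m, `|a n m| <= M m) ->
  exists phi : nat -> nat, {homo phi : m n / (m < n)%N >-> (m < n)%N} /\
    forall m, cvgn (fun n => a (phi n) m).
Proof.
move=> aM.
pose K := [set f : prod_topology (fun _ : nat => R) |
  forall i, ((`[- M i, M i])%classic : set R) (f i)].
have cK : compact K.
  by apply: (@tychonoff nat (fun=> R) (fun i => (`[- M i, M i])%classic)) => i;
    exact: segment_compact.
pose F := (a : nat -> prod_topology (fun _ : nat => R)) @ \oo.
have FK : F K.
  by exists 0%N => // n _ i /=; rewrite in_itv/= -ler_norml.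
have [z [_ zF]] := cK F _ FK.
have hyp k N : exists n, (N <= n)%N /\
    forall m, (m <= k)%N -> `|a n m - z m| < k.+1%:R^-1.
  have U : nbhs z [set y : prod_topology (fun _ : nat => R) |
      forall m, (m <= k)%N -> `|y m - z m| < k.+1%:R^-1].
    have Um (m : nat) : nbhs z [set y : prod_topology (fun _ : nat => R) |
        `|y m - z m| < k.+1%:R^-1].
      have := @proj_continuous nat (fun=> R) m z.
      move=> /(_ [set y | `|y - z m| < k.+1%:R^-1]); apply.
      have e0 : 0 < k.+1%:R^-1 :> R by rewrite invr_gt0.
      by exists (k.+1%:R^-1) => //= y /=; rewrite distrC.
    (* Finitely many coordinates are constrained one after the other; the pattern [{-2}k] leaves the
       radius fixed while their number grows. *)
    elim: {-2}k => [|j IH].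
      by apply: filterS (Um 0%N) => y hy m; rewrite leqn0 => /eqP ->.
    apply: filterS2 IH (Um j.+1) => y h1 h2 m; rewrite leq_eqVlt => /predU1P[->//|].
    by rewrite ltnS; exact: h1.
  have FN : F [set a n | n in [set n | (N <= n)%N]].
    by exists N => // n /= Nn; exists n.
  have [y [[n Nn <-] hy]] := zF _ _ FN U.
  by exists n.
have [phi [phi_incr phiP]] := exists_subsequence hyp.
exists phi; split => // m; apply/cvg_ex; exists (z m).
apply/cvgrPdist_lt => e e0.
have [N hN] : exists N : nat, e^-1 < N.+1%:R.
  by exists (Num.truncn e^-1); exact: truncnS_gt.
exists (maxn N m) => // k /=; rewrite geq_max => /andP[Nk mk].
rewrite distrC (lt_trans (phiP k m mk))// -[e]invrK ltf_pV2 ?posrE ?invr_gt0//.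
by rewrite (lt_le_trans hN)// ler_nat.
Qed.

(** The subsequence is chosen so that the products with each [u m] converge. The vectors [a] for
    which B (u (phi n)) a converges form a closed submodule [S] containing every [u n], and the
    limit is a bounded functional on [S], represented there by [u0]. Vectors outside [S] are
    replaced by their projections on it. *)
Lemma weak_sequential_compactness (D : set T) (B : T -> T -> R) (M : R)
    (u : nat -> T) :
  semi_inner D B -> complete_for D B -> (forall n, D (u n)) ->
  (forall n, B (u n) (u n) <= M) ->
  exists phi : nat -> nat, {homo phi : m n / (m < n)%N >-> (m < n)%N} /\
  exists u0, D u0 /\ forall a, D a -> B (u (phi n)) a @[n --> \oo] --> B u0 a.
Proof.
move=> DB Dcomp Du uM.
have Dsub : submodule D by case: DB.
have BC a b : D a -> D b -> B a b = B b a by case: DB => _ + _ _; exact.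
have Blin c : D c -> linear_on D (B ^~ c) by case: DB => _ _ + _; exact.
have uB n a : D a -> `|B (u n) a| <= Num.sqrt M * Num.sqrt (B a a).
  move=> Da; apply: le_trans (cauchy_schwarz_sqrt DB (Du n) Da) _.
  by rewrite ler_wpM2r ?sqrtr_ge0// ler_wsqrtr.
have [phi [phi_incr phi_cvg]] := @subsequence_rows_cvg
  (fun n m => B (u n) (u m)) _ (fun n m => uB n _ (Du m)).
exists phi; split => //.
pose S := [set a | D a /\ cvgn (fun n => B (u (phi n)) a)].
have SD : S `<=` D by move=> a [].
have uS n : S (u n) by [].
have Slin k a b : S a -> S b -> S (k *: a + b) /\
    limn (fun n => B (u (phi n)) (k *: a + b)) =
    k * limn (fun n => B (u (phi n)) a) + limn (fun n => B (u (phi n)) b).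
  move=> [Da ca] [Db cb].
  have Dab : D (k *: a + b) by exact: Dsub.2.
  have h : B (u (phi n)) (k *: a + b) @[n --> \oo] -->
      k * limn (fun n => B (u (phi n)) a) + limn (fun n => B (u (phi n)) b).
    under eq_cvg do rewrite BC// Blin// (BC a)// (BC b)//.
    by apply: cvgD => //; apply: cvgMr.
  split; last exact: cvg_lim.
  by split => //; apply/cvg_ex; eexists; exact: h.
have Ssub : submodule S.
  split; last by move=> k a b Sa Sb; exact: (Slin k a b Sa Sb).1.
  rewrite -[0](subrr (u 0%N)) -scaleN1r addrC; exact: (Slin _ _ _ (uS _) (uS _)).1.
(* [S] is closed: as the [u n] are bounded, B (u n) (w k) is close to B (u n) l uniformly in n, so
   the limit along [w k] serves as centre for a Cauchy estimate along [l]. *)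
have Scomp : complete_for S B.
  move=> w Sw cw.
  have Dw n : D (w n) := SD _ (Sw n).
  have [l [Dl wl]] := Dcomp w Dw cw.
  exists l; split => //; split => //.
  have Dwl n : D (w n - l) by apply: submodule_sub.
  apply/cauchy_cvgP/cauchy_exP => e e0.
  have e3 : 0 < e / 2 by rewrite divr_gt0.
  have [k hk] : exists k, Num.sqrt M * Num.sqrt (B (w k - l) (w k - l)) < e / 2.
    have h : Num.sqrt M * Num.sqrt (B (w n - l) (w n - l)) @[n --> \oo] --> (0 : R).
      rewrite -[X in _ --> X](mulr0 (Num.sqrt M)) -sqrtr0; apply: cvgMr.
      by apply: continuous_cvg wl; exact: sqrt_continuous.
    have /cvgrPdist_lt/(_ _ e3)[N _ hN] := h.
    exists N; have := hN N (leqnn N); rewrite /= sub0r normrN.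
    exact/le_lt_trans/ler_norm.
  have uBk n : `|B (u n) (w k) - B (u n) l| < e / 2.
    rewrite (BC _ (w k))// (BC _ l)// -(semi_innerBl DB)// BC//.
    exact: le_lt_trans (uB n _ (Dwl k)) hk.
  exists (limn (fun n => B (u (phi n)) (w k))).
  have /cvgrPdist_lt/(_ _ e3) := (Sw k).2.
  apply: filterS => n /= hn; rewrite /ball/=.
  rewrite (le_lt_trans (ler_distD (B (u (phi n)) (w k)) _ _))//.
  by rewrite [e]splitr ltrD.
have [u0 [Su0 hu0]] : exists v, S v /\ forall a, S a ->
    limn (fun n => B (u (phi n)) a) = B a v.
  apply: (@riesz_representation D B DB S _ (Num.sqrt M)) => //.
    by move=> k a b Sa Sb; exact: (Slin k a b Sa Sb).2.
  move=> a [Da ca].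
  have h : `|B (u (phi n)) a| @[n --> \oo] --> `|limn (fun n => B (u (phi n)) a)|.
    exact: cvg_norm ca.
  apply: cvgr_to_le h _.
  by apply: nearW => n; exact: uB.
exists u0; split; first exact: SD.
move=> a Da.
(* [a'] is a projection of [a] on [S], obtained as the vector that represents B ^~ a there; both
   [u (phi n)] and [u0] lie in [S], so [a] may be exchanged for [a']. *)
have [a' [Sa' ha']] : exists v, S v /\ forall b, S b -> B b a = B b v.
  apply: (@riesz_representation D B DB S (B ^~ a) (Num.sqrt (B a a))) => //.
    by move=> k b c Sb Sc; apply: Blin => //; exact: SD.
  by move=> b Sb; rewrite mulrC; apply: (cauchy_schwarz_sqrt DB) => //; exact: SD.
under eq_cvg do rewrite ha'//.
rewrite ha'// (BC _ _ (SD _ Su0) (SD _ Sa')) -hu0//.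
exact: Sa'.2.
Qed.

End semi_inner_product.

(** * Convergence in [L^2] *)

Section L2_convergence.
Context d (T : measurableType d) (R : realType) (mu : {measure set T -> \bar R}).
Implicit Types (f h : nat -> T -> R) (G : T -> \bar R).

(** The majorant of the Riesz-Fischer theorem, G = sum_k (2^k h_k)^2: the weight 4^k against 8^-k
    leaves a geometric series with sum at most 2. Where G is finite, |h_k| <= sqrt G * 2^-k. *)
Lemma exists_L2_majorant h : (forall k, measurable_fun setT (h k)) ->
  (forall k, (\int[mu]_x (h k x ^+ 2)%:E <= (8^-1 ^+ k)%:E)%E) ->
  exists G, [/\ measurable_fun setT G, (forall x, 0 <= G x)%E,
    (\int[mu]_x G x <= 2%:E)%E &
    forall k x, (((2 ^+ k * h k x) ^+ 2)%:E <= G x)%E].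
Proof.
move=> mh hk.
pose g k x : \bar R := ((2 ^+ k * h k x) ^+ 2)%:E.
have mg k : measurable_fun setT (g k).
  by apply/measurable_EFinP; apply: measurable_funX; apply: measurable_funM.
have g0 k x : (0 <= g k x)%E by rewrite lee_fin sqr_ge0.
have leG k x : (g k x <= \sum_(0 <= k <oo) g k x)%E.
  apply: le_trans (nneseries_lim_ge k.+1 _); last by move=> *; exact: g0.
  by rewrite big_nat_recr//= leeDr// sume_ge0.
exists (fun x => \sum_(0 <= k <oo) g k x)%E; split.
- apply: (@emeasurable_fun_cvg _ _ _ _ (fun n x => \sum_(0 <= k < n) g k x)%E).
    by move=> n; apply: emeasurable_sum => i; exact: mg.
  move=> x _; apply: is_cvg_nneseries => k _ _; exact: g0.
- by move=> x; apply: nneseries_ge0 => *; exact: g0.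
- rewrite integral_nneseries//.
  apply: lime_le; first by apply: is_cvg_nneseries => *; exact: integral_ge0.
  apply: nearW => n.
  have H k : (\int[mu]_x g k x <= (2^-1 ^+ k)%:E)%E.
    under eq_integral do rewrite /g exprMn EFinM.
    have mh2 : measurable_fun setT (fun x => (h k x ^+ 2)%:E).
      by apply/measurable_EFinP; exact: measurable_funX.
    rewrite ge0_integralZl ?lee_fin ?sqr_ge0//; last first.
      by move=> x _; rewrite lee_fin sqr_ge0.
    apply: (@le_trans _ _ ((2 ^+ k) ^+ 2 * (8^-1 ^+ k))%:E).
      by rewrite [leRHS]EFinM lee_wpmul2l// lee_fin sqr_ge0.
    rewrite lee_fin -exprM mulnC exprM -exprMn -natrX (_ : _ * _ = 2^-1)//.
    by field.
  apply: (@le_trans _ _ (\sum_(0 <= k < n) (2^-1 ^+ k)%:E)%E); first exact: lee_sum.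
  rewrite sumEFin lee_fin.
  have -> : \sum_(0 <= k < n) 2^-1 ^+ k = 2 - 2 * 2^-1 ^+ n :> R.
    elim: n => [|n IH]; first by rewrite big_geq// expr0 mulr1 subrr.
    by rewrite big_nat_recr//= IH exprS mulrA divff// mul1r; lra.
  by rewrite lerBlDr lerDl mulr_ge0// exprn_ge0.
- exact: leG.
Qed.

Lemma geometric_steps_cvg (a : nat -> R) (c : R) :
  (forall k, `|a k.+1 - a k| <= c * 2^-1 ^+ k) ->
  cvgn a /\ forall k, `|a k - limn a| <= 2 * c * 2^-1 ^+ k.
Proof.
move=> ac.
have c0 : 0 <= c by have := le_trans (normr_ge0 _) (ac 0%N); rewrite expr0 mulr1.
have tele k m : `|a (m + k)%N - a k| <= 2 * c * (2^-1 ^+ k - 2^-1 ^+ (m + k)).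
  elim: m => [|m IH]; first by rewrite !add0n !subrr normr0 mulr0.
  rewrite addSn (le_trans (ler_distD (a (m + k)%N) _ _))//.
  rewrite (le_trans (lerD (ac _) IH))// exprS; lra.
have le2 k n : (k <= n)%N -> `|a n - a k| <= 2 * c * 2^-1 ^+ k.
  move=> /subnK <-; apply: le_trans (tele _ _) _.
  by rewrite ler_wpM2l ?mulr_ge0// lerBlDr lerDl exprn_ge0.
have geo : 2 * c * 2^-1 ^+ n @[n --> \oo] --> (0 : R).
  rewrite -[X in _ --> X](mulr0 (2 * c)); apply: cvgMr.
  by apply: cvg_expr; rewrite ger0_norm ?invr_ge0// invf_lt1 ?ltr1n.
have ca : cvgn a.
  apply/cauchy_cvgP/cauchy_exP => e e0.
  have /cvgrPdist_lt/(_ _ e0)[N _ hN] := geo.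
  exists (a N), N => // n /= Nn; rewrite /ball/= distrC (le_lt_trans (le2 _ _ Nn))//.
  by have := hN _ (leqnn N); rewrite /= sub0r normrN; exact/le_lt_trans/ler_norm.
split => // k.
have h : `|a k - a n| @[n --> \oo] --> `|a k - limn a|.
  by apply: cvg_norm; apply: cvgB => //; exact: cvg_cst.
apply: cvgr_to_le h _; exists k => // n /= kn; rewrite distrC; exact: le2.
Qed.

Lemma L2_majorantP (h : nat -> T -> R) G x k : G x \is a fin_num ->
  (((2 ^+ k * h k x) ^+ 2)%:E <= G x)%E ->
  `|h k x| <= Num.sqrt (fine (G x)) * 2^-1 ^+ k.
Proof.
move=> Gx; rewrite -{1}(fineK Gx) lee_fin => hG.
rewrite exprVn ler_pdivlMr ?exprn_gt0// mulrC.
rewrite -[X in X <= _](ger0_norm (mulr_ge0 _ _)) ?exprn_ge0//.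
by rewrite normrM normr_id -normrM -sqrtr_sqr ler_wsqrtr.
Qed.

(** Where the majorant G of the steps is finite, the sequence converges geometrically, with squared
    error at most (2 sqrt G 2^-k)^2 = 4 * 4^-k * G. Since int G <= 2, this integrates to 8 *
    4^-k. *)
Lemma L2_fast_complete f : (forall k, measurable_fun setT (f k)) ->
  (forall k, (\int[mu]_x ((f k.+1 x - f k x) ^+ 2)%:E <= (8^-1 ^+ k)%:E)%E) ->
  exists g : T -> R, measurable_fun setT g /\
    forall k, (\int[mu]_x ((f k x - g x) ^+ 2)%:E <= (8 * 4^-1 ^+ k)%:E)%E.
Proof.
move=> mf hf.
have [G [mG G0 intG leG]] := @exists_L2_majorant (fun k x => f k.+1 x - f k x)
  (fun k => measurable_funB (mf k.+1) (mf k)) hf.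
pose A := [set x | G x \is a fin_num].
have mA : measurable A by rewrite -[A]setTI; exact: emeasurable_fin_num.
pose fA k x := f k x * \1_A x.
have stepA x : A x -> cvgn (f ^~ x) /\
    forall k, `|f k x - limn (f ^~ x)| <= 2 * Num.sqrt (fine (G x)) * 2^-1 ^+ k.
  move=> Ax; apply: geometric_steps_cvg => k.
  exact: (@L2_majorantP (fun k x => f k.+1 x - f k x) G).
(* Off [A] the value 0 makes [g] an everywhere limit of the measurable functions [fA k]. *)
pose g x := if x \in A then limn (f ^~ x) else 0.
have fAg x : fA k x @[k --> \oo] --> g x.
  rewrite /fA /g indicE; case: ifPn => xA.
    under eq_cvg do rewrite mulr1.
    by apply: (stepA x _).1; rewrite inE in xA.
  by under eq_cvg do rewrite mulr0; exact: cvg_cst.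
have mg : measurable_fun setT g.
  apply: (@measurable_fun_cvg _ _ _ _ fA) => [k|x _]; last exact: fAg.
  by apply: measurable_funM => //; exact: measurable_indic.
exists g; split => // k.
have mGk : measurable_fun setT (fun x => (4 * 4^-1 ^+ k)%:E * G x)%E.
  exact: measurable_funeM.
apply: (@le_trans _ _ (\int[mu]_x ((4 * 4^-1 ^+ k)%:E * G x))%E); last first.
  rewrite ge0_integralZl// ?lee_fin ?mulr_ge0 ?exprn_ge0//.
  rewrite (_ : 8 * _ = 4 * 4^-1 ^+ k * 2); last by lra.
  by rewrite [leRHS]EFinM lee_wpmul2l// lee_fin mulr_ge0// exprn_ge0.
apply: ge0_le_integral => //.
- by move=> x _; rewrite lee_fin sqr_ge0.
- by apply/measurable_EFinP; apply: measurable_funX; apply: measurable_funB.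
- move=> x _; have [Ax|] := boolP (G x \is a fin_num); last first.
    rewrite ge0_fin_numE// -leNgt leye_eq => /eqP ->.
    by rewrite gt0_muley ?leey// lte_fin mulr_gt0// exprn_gt0.
  rewrite -(fineK Ax) -EFinM lee_fin /g mem_set//.
  rewrite -real_normK ?num_real//.
  apply: le_trans (lerXn2r 2 _ _ ((stepA x Ax).2 k)) _.
  - by rewrite nnegrE.
  - by rewrite nnegrE !mulr_ge0 ?sqrtr_ge0 ?exprn_ge0.
  rewrite !exprMn sqr_sqrtr ?fine_ge0// -natrX -exprM mulnC exprM.
  have -> : 2^-1 ^+ 2 = 4^-1 :> R by rewrite exprVn -natrX.
  by rewrite mulrAC.
Qed.

(** The same majorant, applied to the errors f k - g: it is integrable, hence finite almost
    everywhere. *)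
Lemma L2_fast_cvg_ae f (g : T -> R) : (forall k, measurable_fun setT (f k)) ->
  measurable_fun setT g ->
  (forall k, (\int[mu]_x ((f k x - g x) ^+ 2)%:E <= (8^-1 ^+ k)%:E)%E) ->
  {ae mu, forall x, f k x @[k --> \oo] --> g x}.
Proof.
move=> mf mg hf.
have [G [mG G0 intG leG]] := @exists_L2_majorant (fun k x => f k x - g x)
  (fun k => measurable_funB (mf k) mg) hf.
have iG : mu.-integrable setT G.
  apply/integrableP; split => //; under eq_integral do rewrite gee0_abs//.
  by rewrite (le_lt_trans intG)// ltry.
apply: filterS (integrable_ae measurableT iG) => x /(_ I) Gx.
apply/subr_cvg0/norm_cvg0P.
apply: (@squeeze_cvgr _ _ _ _ (fun=> 0)
  (fun k => Num.sqrt (fine (G x)) * 2^-1 ^+ k)).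
- apply: nearW => k; rewrite normr_ge0/=.
  exact: (@L2_majorantP (fun k x => f k x - g x) G).
- exact: cvg_cst.
- rewrite -[X in _ --> X](mulr0 (Num.sqrt (fine (G x)))); apply: cvgMr.
  by apply: cvg_expr; rewrite ger0_norm ?invr_ge0// invf_lt1 ?ltr1n.
Qed.

End L2_convergence.

(** * Calculus on the plane *)

Section plane_calculus.
Context (R : realType).
Local Notation lambda := (@lebesgue_measure R).
Local Notation lambda2 := (@leb2 R).
Implicit Types (f : R * R -> R) (g : R -> R) (a b : R).

(** Measurability on the plane refers to the product sigma-algebra, so an open set is written as the
    countable union of the rational boxes it contains. *)
Lemma open_measurable_plane (U : set (R * R)) : open U -> measurable U.
Proof.
move=> oU.
pose box (q : (rat * rat) * (rat * rat)) : set (R * R) :=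
  `]ratr q.1.1, ratr q.1.2[%classic `*` `]ratr q.2.1, ratr q.2.2[%classic.
pose F q := if `[< box q `<=` U >] then box q else set0.
have -> : U = \bigcup_q F q.
  apply/seteqP; split => [[x y] Uxy|z [q _]]; last first.
    by rewrite /F; case: asboolP => // h; exact: h.
  have /nbhs_ballP[e /= e0 hU] := open_nbhs_nbhs (conj oU Uxy).
  have near (z : R) : exists q : rat * rat,
      [/\ z - e < ratr q.1, ratr q.1 < z, z < ratr q.2 & ratr q.2 < z + e].
    have ze : z - e < z by rewrite ltrBlDr ltrDl.
    have ez : z < z + e by rewrite ltrDl.
    have [a] := rat_in_itvoo ze; have [b] := rat_in_itvoo ez.
    by rewrite !in_itv/= => /andP[? ?] /andP[? ?]; exists (a, b).
  have [qx [? ? ? ?]] := near x; have [qy [? ? ? ?]] := near y.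
  exists (qx, qy) => //; rewrite /F asboolT; first by split; rewrite /= in_itv/=; apply/andP.
  move=> -[s t] [/=]; rewrite !in_itv/= => /andP[? ?] /andP[? ?]; apply: hU.
  by split; rewrite /ball/= ltr_distlC; apply/andP; split; lra.
apply: countable_bigcupT_measurable; first exact: countableP.
move=> q; rewrite /F; case: asboolP => _ //.
by apply: measurableX; exact: measurable_itv.
Qed.

Lemma continuous_measurable_plane f : continuous f -> measurable_fun setT f.
Proof.
move=> /continuousP cf; apply: (measurability _ (RGenOpens.measurableE R)).
move=> _ [_ [a [b ->] <-]]; rewrite setTI; apply: open_measurable_plane.
exact/cf/interval_open.
Qed.

Lemma is_derive_line1 f x y : derivable f (x, y) (e1 R) ->
  is_derive x 1 (fun s => f (s, y)) (d1 f (x, y)).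
Proof.
have E : (fun h : R => h^-1 *: (((fun s => f (s, y)) \o shift x) (h *: 1) - f (x, y)))
       = (fun h => h^-1 *: ((f \o shift (x, y)) (h *: e1 R) - f (x, y))).
  apply/funext => h /=; congr (_ *: (f (_, _) - _)).
  by rewrite /= scaler0 add0r.
by move=> df; apply: DeriveDef; rewrite /derivable /d1 /derive E.
Qed.

Lemma is_derive_line2 f x y : derivable f (x, y) (e2 R) ->
  is_derive y 1 (fun t => f (x, t)) (d2 f (x, y)).
Proof.
have E : (fun h : R => h^-1 *: (((fun t => f (x, t)) \o shift y) (h *: 1) - f (x, y)))
       = (fun h => h^-1 *: ((f \o shift (x, y)) (h *: e2 R) - f (x, y))).
  apply/funext => h /=; congr (_ *: (f (_, _) - _)).
  by rewrite /= scaler0 add0r.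
by move=> df; apply: DeriveDef; rewrite /derivable /d2 /derive E.
Qed.

Lemma continuous_line1 f y : continuous f -> continuous (fun s => f (s, y)).
Proof.
move=> cf x; apply: (@continuous_comp _ _ _ (fun s => (s, y)) f); last exact: cf.
by apply: (@cvg_pair _ _ _ _ (nbhs x) (nbhs y)); [exact: cvg_id|exact: cvg_cst].
Qed.

Lemma continuous_line2 f x : continuous f -> continuous (fun t => f (x, t)).
Proof.
move=> cf y; apply: (@continuous_comp _ _ _ (fun t => (x, t)) f); last exact: cf.
by apply: (@cvg_pair _ _ _ _ (nbhs x) (nbhs y)); [exact: cvg_cst|exact: cvg_id].
Qed.

Lemma integral_derivative g g' a b : a < b ->
  (forall x : R, is_derive x (1 : R) g (g' x)) -> continuous g' ->
  (\int[lambda]_(s in `[a, b]) (g' s)%:E = (g b - g a)%:E)%E.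
Proof.
move=> ab dg cg'.
have cg : continuous g.
  by move=> x; apply/differentiable_continuous/derivable1_diffP; case: (dg x).
rewrite (@continuous_FTC2 R g' g)// ?EFinB//.
- by apply: continuous_subspaceT.
- split => [x _||].
  + by case: (dg x).
  + exact/cvg_at_right_filter/cg.
  + exact/cvg_at_left_filter/cg.
- by move=> x _; rewrite derive1E; case: (dg x).
Qed.

Lemma continuous_integrable_itv g a b : continuous g ->
  lambda.-integrable `[a, b] (EFin \o g).
Proof.
move=> cg; apply: continuous_compact_integrable; first exact: segment_compact.
exact: continuous_subspaceT.
Qed.

Lemma norm_increment_le g g' a b : a <= b ->
  (forall x : R, is_derive x (1 : R) g (g' x)) -> continuous g' ->
  (`|g b - g a|%:E <= \int[lambda]_(s in `[a, b]) `|g' s|%:E)%E.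
Proof.
rewrite le_eqVlt => /predU1P[<-|ab] dg cg'.
  by rewrite subrr normr0; apply: integral_ge0 => x _; rewrite lee_fin.
rewrite -abse_EFin -integral_derivative//.
apply: (@le_abse_integral _ _ _ lambda) => //.
by apply/measurable_EFinP; apply: measurable_funTS; exact: continuous_measurable_fun.
Qed.

(** Cauchy-Schwarz for the product of g' and 1, read off the quadratic t -> int (t g' + 1)^2, whose
    middle coefficient is g b - g a. *)
Lemma sqr_increment_le g g' a b : a <= b ->
  (forall x : R, is_derive x (1 : R) g (g' x)) -> continuous g' ->
  (((g b - g a) ^+ 2)%:E <= (b - a)%:E * \int[lambda]_(s in `[a, b]) (g' s ^+ 2)%:E)%E.
Proof.
rewrite le_eqVlt => /predU1P[<-|ab] dg cg'.
  by rewrite !subrr mul0e expr0n.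
have iC h : continuous h -> lambda.-integrable `[a, b] (EFin \o h).
  exact: continuous_integrable_itv.
have cg2 : continuous (fun s => g' s ^+ 2).
  by move=> x; apply: cvgM; exact: cg'.
have fin : (\int[lambda]_(s in `[a, b]) (g' s ^+ 2)%:E)%E \is a fin_num.
  by apply: integrable_fin_num => //; exact: (iC _ cg2).
rewrite -(fineK fin) -EFinM lee_fin mulrC.
apply: sqr_le_discriminant => [|t].
  by rewrite fine_ge0// integral_ge0// => x _; rewrite lee_fin sqr_ge0.
have c1 : continuous (fun s => t ^+ 2 * g' s ^+ 2).
  by move=> x; apply: cvgMr; exact: cg2.
have c2 : continuous (fun s => 2 * t * g' s).
  by move=> x; apply: cvgMr; exact: cg'.
have c12 : continuous (fun s => t ^+ 2 * g' s ^+ 2 + 2 * t * g' s).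
  by move=> x; apply: cvgD; [exact: c1|exact: c2].
have c3 : continuous (fun _ : R => 1 : R) by move=> x; exact: cvg_cst.
have : (0 <= \int[lambda]_(s in `[a, b]) (t ^+ 2 * g' s ^+ 2 + 2 * t * g' s + 1)%:E)%E.
  apply: integral_ge0 => s _; rewrite lee_fin.
  rewrite (_ : _ + 1 = (t * g' s + 1) ^+ 2) ?sqr_ge0//; ring.
under eq_integral do rewrite EFinD.
rewrite integralD//=; [|exact: (iC _ c12)|exact: (iC _ c3)].
under eq_integral do rewrite EFinD.
rewrite integralD//=; [|exact: (iC _ c1)|exact: (iC _ c2)].
under eq_integral do rewrite EFinM.
rewrite integralZl//; last exact: (iC _ cg2).
under [X in (_ + X + _)%E]eq_integral do rewrite EFinM.
rewrite integralZl//; last exact: (iC _ cg').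
rewrite integral_derivative// integral_cst//= lebesgue_measure_itv/= lte_fin ab.
rewrite mul1e -(fineK fin).
by rewrite -!EFinM -!EFinD lee_fin.
Qed.

End plane_calculus.

(** * Test functions *)

HB.instance Definition _ (R : realType) := gen_eqMixin (hv R).
HB.instance Definition _ (R : realType) := gen_choiceMixin (hv R).

(** * Vector space structure on triples *)

Section hv_lmodule.
Context (R : realType).
Implicit Types a b c : hv R.

Let hv_zero : hv R := HV (fun=> 0) (fun=> 0) (fun=> 0).
Let hv_opp a : hv R := hv_scale (-1) a.

Lemma hvP a b : hv_u a =1 hv_u b -> hv_g1 a =1 hv_g1 b -> hv_g2 a =1 hv_g2 b -> a = b.
Proof.
by case: a b => [? ? ?] [? ? ?] /= /funext -> /funext -> /funext ->.
Qed.

Let hv_addA : associative (@hv_add R).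
Proof. by move=> a b c; apply: hvP => x /=; rewrite addrA. Qed.
Let hv_addC : commutative (@hv_add R).
Proof. by move=> a b; apply: hvP => x /=; rewrite addrC. Qed.
Let hv_add0 : left_id hv_zero (@hv_add R).
Proof. by move=> a; apply: hvP => x /=; rewrite add0r. Qed.
Let hv_addN : left_inverse hv_zero hv_opp (@hv_add R).
Proof. by move=> a; apply: hvP => x /=; rewrite mulN1r addNr. Qed.

HB.instance Definition _ := GRing.isZmodule.Build (hv R)
  hv_addA hv_addC hv_add0 hv_addN.

Let hv_scaleA k l a : hv_scale k (hv_scale l a) = hv_scale (k * l) a.
Proof. by apply: hvP => x /=; rewrite mulrA. Qed.
Let hv_scale1 : left_id 1 (@hv_scale R).
Proof. by move=> a; apply: hvP => x /=; rewrite mul1r. Qed.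
Let hv_scaleDr : right_distributive (@hv_scale R) +%R.
Proof. by move=> k a b; apply: hvP => x /=; rewrite mulrDr. Qed.
Let hv_scaleDl a : {morph (@hv_scale R) ^~ a : k l / k + l}.
Proof. by move=> k l; apply: hvP => x /=; rewrite mulrDl. Qed.

HB.instance Definition _ := GRing.Zmodule_isLmodule.Build R (hv R)
  hv_scaleA hv_scale1 hv_scaleDr hv_scaleDl.

Lemma hv_uB a b x : hv_u (a - b) x = hv_u a x - hv_u b x.
Proof. by rewrite /= mulN1r. Qed.
Lemma hv_g1B a b x : hv_g1 (a - b) x = hv_g1 a x - hv_g1 b x.
Proof. by rewrite /= mulN1r. Qed.
Lemma hv_g2B a b x : hv_g2 (a - b) x = hv_g2 a x - hv_g2 b x.
Proof. by rewrite /= mulN1r. Qed.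

End hv_lmodule.

(** * Linearity, continuity and support of test functions *)

Section test_functions.
Context (R : realType).
Implicit Types (f g : R * R -> R) (l : seq bool).

Lemma iterD_lin l k f g : smooth f -> smooth g ->
  iterD l (fun x => k * f x + g x) = (fun x => k * iterD l f x + iterD l g x).
Proof.
move=> sf sg; elim: l => //= b l ->; apply/funext => x.
have df := (sf l).2 b x; have dg := (sg l).2 b x.
have df' : derivable (k \*: iterD l f) x (if b then e1 R else e2 R).
  exact: derivableZ.
have -> : (fun x => k * iterD l f x + iterD l g x) = (k \*: iterD l f) + iterD l g.
  by [].
by case: b df dg df' => df dg df'; rewrite /d1 /d2 deriveD// deriveZ.
Qed.

Lemma smooth_lin k f g : smooth f -> smooth g -> smooth (fun x => k * f x + g x).
Proof.
move=> sf sg l; rewrite iterD_lin//; split => [x|b x].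
  apply: cvgD; last exact: (sg l).1.
  by apply: cvgMr; exact: (sf l).1.
have df := (sf l).2 b x; have dg := (sg l).2 b x.
have -> : (fun x => k * iterD l f x + iterD l g x) = (k \*: iterD l f) + iterD l g.
  by [].
by apply: derivableD => //; exact: derivableZ.
Qed.

Lemma test_fun_lin k f g : test_fun f -> test_fun g ->
  test_fun (fun x => k * f x + g x).
Proof.
move=> [sf cf] [sg cg]; split; first exact: smooth_lin.
apply: (subclosed_compact _ (compactU cf cg)); first exact: closed_closure.
rewrite -closureU; apply: closureS => x /=.
by have [->|] := eqVneq (f x) 0; [rewrite mulr0 add0r; right|left].
Qed.

Lemma test_fun0 : test_fun (fun _ : R * R => 0 : R).
Proof.
have E l : iterD l (fun _ : R * R => 0 : R) = (fun=> 0).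
  elim: l => //= b l ->; apply/funext => x.
  by case: b; rewrite /d1 /d2; exact: derive_cst.
split => [l|].
  rewrite E; split => [x|b x]; [exact: cvg_cst|exact: derivable_cst].
rewrite (_ : [set x | _] = set0) ?closure0; first exact: compact0.
by apply/seteqP; split => x //=; rewrite eqxx.
Qed.

Lemma test_fun_continuous f : test_fun f ->
  [/\ continuous f, continuous (d1 f) & continuous (d2 f)].
Proof.
by move=> [sf _]; split;
  [exact: (sf [::]).1|exact: (sf [:: true]).1|exact: (sf [:: false]).1].
Qed.

Lemma test_fun_derivable1 f x : test_fun f -> derivable f x (e1 R).
Proof. by move=> [sf _]; exact: (sf [::]).2 true x. Qed.

Lemma test_fun_derivable2 f x : test_fun f -> derivable f x (e2 R).
Proof. by move=> [sf _]; exact: (sf [::]).2 false x. Qed.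

Lemma near0_derive f x v : (\forall y \near x, f y = 0) -> derive f x v = 0.
Proof.
move=> fx; rewrite /derive; apply: cvg_lim => //.
have fx0 : f x = 0 by exact: nbhs_singleton fx.
apply: cvg_near_cst.
have c : h *: v + x @[h --> (0 : R)] --> (0 : R) *: v + x.
  by apply: cvgD; [exact: scalel_continuous|exact: cvg_cst].
rewrite scale0r add0r in c.
have h0 : \forall h \near (0 : R), f (h *: v + x) = 0 := c _ fx.
have : \forall h \near (0 : R)^', f (h *: v + x) = 0 by exact: nbhs_dnbhs h0.
by apply: filterS => h /= ->; rewrite fx0 subrr scaler0.
Qed.

(** The norm of [R * R] is the maximum norm, so [rho] bounds a square. Off the closed support f
    vanishes in a neighbourhood, which kills its derivatives as well. *)
Lemma test_fun_support f : test_fun f -> exists rho : R, 0 < rho /\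
  forall x : R * R, rho < `|x| -> [/\ f x = 0, d1 f x = 0 & d2 f x = 0].
Proof.
move=> [_ cf]; have [M [_ hM]] := compact_bounded cf.
pose r := Num.max 1 (M + 1).
have Mr : M < r by rewrite /r lt_max ltrDl ltr01 orbT.
exists r; split; first by rewrite lt_max ltr01.
move=> x rx.
have nK : (~` closure [set y | f y != 0]) x.
  by move=> /(hM _ Mr) /= /le_lt_trans /(_ rx); rewrite ltxx.
have near0 : \forall y \near x, f y = 0.
  have : nbhs x (~` closure [set y | f y != 0]).
    by apply: open_nbhs_nbhs; split => //; exact/closed_openC/closed_closure.
  apply: filterS => y ny; apply/eqP; apply: contrapT => /negP fy.
  by apply: ny; exact: subset_closure.
by split; [exact: nbhs_singleton near0|exact: near0_derive|exact: near0_derive].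
Qed.

Lemma integral_compact_support_lty f rho : continuous f -> (forall x, 0 <= f x) ->
  (forall x : R * R, rho < `|x| -> f x = 0) ->
  (\int[@leb2 R]_x (f x)%:E < +oo)%E.
Proof.
move=> cf f0 fsupp.
pose K : set (R * R) := `[- rho, rho]%classic `*` `[- rho, rho]%classic.
have cK : compact K by apply: compact_setX; exact: segment_compact.
have mK : measurable K by apply: measurableX; exact: measurable_itv.
have [M [_ hM]] : bounded_set (f @` K).
  by apply/compact_bounded/continuous_compact => //; exact: continuous_subspaceT.
have fM x : K x -> f x <= `|M| + 1.
  move=> Kx; apply: le_trans (ler_norm _) (hM _ _ _ _); last by exists x.
  by rewrite (le_lt_trans (ler_norm _))// ltrDl.
have mf : measurable_fun setT (EFin \o f).
  by apply/measurable_EFinP; exact: continuous_measurable_plane.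
apply: (@le_lt_trans _ _ (\int[@leb2 R]_(x in K) (`|M| + 1)%:E)%E).
  rewrite [leRHS]integral_mkcond; apply: ge0_le_integral => //.
  - by move=> x _; rewrite lee_fin.
  - by apply/(measurable_restrictT _ mK); exact: measurable_cst.
  - move=> x _; rewrite patchE; case: ifPn => [|/negP nK].
      by rewrite inE lee_fin => /fM.
    rewrite fsupp// ltNge; apply/negP => xr; apply: nK; rewrite inE.
    move: xr; rewrite prod_normE/= ge_max => /andP[x1 x2].
    by split; rewrite /= in_itv/= -ler_norml.
rewrite integral_cst//.
pose I : set R := `[- rho, rho]%classic.
rewrite [X in (_ * X)%E](_ : _ = @lebesgue_measure R I * @lebesgue_measure R I)%E; last first.
  by apply: product_measure1E; exact: measurable_itv.
rewrite !lebesgue_measure_itv/= lte_fin; case: ifPn => _.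
  by rewrite -EFinM ltry.
by rewrite mule0 mule0 ltry.
Qed.

End test_functions.

(** * The space [H^1_V] *)

Ltac solve_measurable := repeat first
  [ assumption | exact: measurable_cst | exact: measurable_id
  | apply: measurable_funD | apply: measurable_funB
  | apply: measurable_funM | apply: measurable_funX | apply: measurable_funN ].

Lemma ge0_integral_le_comb d (T : measurableType d) (R : realType)
    (mu : {measure set T -> \bar R}) (D : set T) (f g h : T -> R) (a b : R) :
  measurable D -> 0 <= a -> 0 <= b ->
  measurable_fun D f -> measurable_fun D g -> measurable_fun D h ->
  (forall x, D x -> 0 <= f x) -> (forall x, D x -> 0 <= g x) ->
  (forall x, D x -> 0 <= h x) ->
  (forall x, D x -> f x <= a * g x + b * h x) ->
  (\int[mu]_(x in D) (f x)%:E <= a%:E * \int[mu]_(x in D) (g x)%:E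
    + b%:E * \int[mu]_(x in D) (h x)%:E)%E.
Proof.
move=> mD a0 b0 mf mg mh f0 g0 h0 le.
have mg' : measurable_fun D (EFin \o g) by apply/measurable_EFinP.
have mh' : measurable_fun D (EFin \o h) by apply/measurable_EFinP.
have ag0 x : D x -> (0 <= a%:E * (g x)%:E)%E by move=> Dx; rewrite mule_ge0// lee_fin g0.
have bh0 x : D x -> (0 <= b%:E * (h x)%:E)%E by move=> Dx; rewrite mule_ge0// lee_fin h0.
have mag : measurable_fun D (fun x => a%:E * (g x)%:E)%E by exact: measurable_funeM.
have mbh : measurable_fun D (fun x => b%:E * (h x)%:E)%E by exact: measurable_funeM.
rewrite -!ge0_integralZl_EFin// -ge0_integralD//.
apply: ge0_le_integral => //.
- exact/measurable_EFinP.
- exact: emeasurable_funD.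
Qed.

Section weighted_sobolev_space.
Context (R : realType) (V : R * R -> R).
Hypothesis Vc : continuous V.
Hypothesis V0 : forall x, 0 < V x.
Local Notation lambda2 := (@leb2 R).
Local Notation HVset := (in_HV V : set (hv R)).
Implicit Types (a b c w : hv R) (f : R * R -> R) (k : R).

Let mV : measurable_fun setT V := continuous_measurable_plane Vc.
Let V0' x : 0 <= V x := ltW (V0 x).

Definition hv_of f : hv R := HV f (d1 f) (d2 f).

Definition hv_meas w := [/\ measurable_fun setT (hv_u w),
  measurable_fun setT (hv_g1 w) & measurable_fun setT (hv_g2 w)].

Definition hv_density a b x : R :=
  hv_g1 a x * hv_g1 b x + hv_g2 a x * hv_g2 b x + V x * (hv_u a x * hv_u b x).

(** A real-valued integral, that is, the [fine] part of the extended one; [hv_density_integrable]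
    makes it bilinear on [in_HV V]. *)
Definition hv_inner a b : R := (\int[lambda2]_x hv_density a b x)%R.

Lemma hv_meas_lin k a b : hv_meas a -> hv_meas b -> hv_meas (k *: a + b).
Proof.
by move=> [? ? ?] [? ? ?]; split; rewrite /=; solve_measurable.
Qed.

Lemma hv_measB a b : hv_meas a -> hv_meas b -> hv_meas (a - b).
Proof. by move=> ma mb; rewrite addrC -scaleN1r; exact: hv_meas_lin. Qed.

Lemma hv_of_meas f : test_fun f -> hv_meas (hv_of f).
Proof.
by move=> /test_fun_continuous[? ? ?]; split; exact: continuous_measurable_plane.
Qed.

Lemma measurable_hv_density a b : hv_meas a -> hv_meas b ->
  measurable_fun setT (hv_density a b).
Proof. by move=> [? ? ?] [? ? ?]; rewrite /hv_density; solve_measurable. Qed.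

Lemma hv_density_ge0 a x : 0 <= hv_density a a x.
Proof.
by rewrite /hv_density -!expr2 !addr_ge0 ?sqr_ge0 // mulr_ge0 ?sqr_ge0.
Qed.

Lemma normV2E a : normV2 V a = (\int[lambda2]_x (hv_density a a x)%:E)%E.
Proof. by apply: eq_integral => x _; rewrite /hv_density -!expr2. Qed.

Lemma normV2_ge0 a : (0 <= normV2 V a)%E.
Proof. by rewrite normV2E; apply: integral_ge0 => x _; rewrite lee_fin hv_density_ge0. Qed.

(** From (k s + t)^2 <= 2 k^2 s^2 + 2 t^2 pointwise. It plays the role of the triangle inequality in
    the extended reals, and is what proves finiteness of the norm in [in_HV_lty]. *)
Lemma normV2_lin_le k a b : hv_meas a -> hv_meas b ->
  (normV2 V (k *: a + b)%R <= (2 * k ^+ 2)%:E * normV2 V a + 2%:E * normV2 V b)%E.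
Proof.
move=> ma mb; rewrite !normV2E; apply: ge0_integral_le_comb => //.
- by rewrite mulr_ge0// sqr_ge0.
- by apply: measurable_hv_density; exact: hv_meas_lin.
- exact: measurable_hv_density.
- exact: measurable_hv_density.
- by move=> x _; exact: hv_density_ge0.
- by move=> x _; exact: hv_density_ge0.
- by move=> x _; exact: hv_density_ge0.
- move=> x _; rewrite /hv_density/=.
  have h (s t : R) : (k * s + t) * (k * s + t) <= 2 * k ^+ 2 * (s * s) + 2 * (t * t).
    have := sqr_ge0 (k * s - t); nra.
  have := h (hv_g1 a x) (hv_g1 b x); have := h (hv_g2 a x) (hv_g2 b x).
  have := ler_wpM2l (V0' x) (h (hv_u a x) (hv_u b x)).
  lra.
Qed.

Lemma normV2_triangle a b c : hv_meas a -> hv_meas b -> hv_meas c ->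
  (normV2 V (a - c)%R <= 2%:E * normV2 V (a - b)%R + 2%:E * normV2 V (b - c)%R)%E.
Proof.
move=> ma mb mc.
have -> : a - c = 1 *: (a - b) + (b - c) by rewrite scale1r addrA subrK.
have := normV2_lin_le 1 (hv_measB ma mb) (hv_measB mb mc).
by rewrite expr1n mulr1.
Qed.

Lemma dist2_testE f w : dist2_test V f w = normV2 V (hv_of f - w)%R.
Proof.
by apply: eq_integral => x _; congr (_%:E); rewrite !hv_uB !hv_g1B !hv_g2B.
Qed.

(** Approximation at every precision instead of along a sequence: linear combinations and limits are
    then treated with one test function at a time, without diagonal sequences. *)
Lemma in_HVP w : in_HV V w <-> hv_meas w /\ forall e : R, 0 < e ->
  exists f, test_fun f /\ (normV2 V (hv_of f - w)%R <= e%:E)%E.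
Proof.
split=> [[mu [m1 [m2 [f [tf fw]]]]]|[[mu m1 m2] h]].
  split => // e e0.
  have /fine_cvgP[[N _ hN] /cvgrPdist_lt/(_ _ e0)[M _ hM]] := fw.
  pose n := maxn N M; exists (f n); split => //; rewrite -dist2_testE.
  have fn : dist2_test V (f n) w \is a fin_num by apply: hN; rewrite /= leq_maxl.
  rewrite -(fineK fn) lee_fin.
  have := hM n (leq_maxr _ _); rewrite /= sub0r normrN => /ltW.
  exact/le_trans/ler_norm.
split => //; split => //; split => //.
have e0 n : 0 < n.+1%:R^-1 :> R by rewrite invr_gt0.
have [f hf] := choice (fun n => h _ (e0 n)).
exists f; split => [n|]; first exact: (hf n).1.
apply: (@squeeze_cvge _ _ _ _ (fun=> 0%E) _ (fun n => (n.+1%:R^-1)%:E)).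
- by apply: nearW => n; rewrite dist2_testE normV2_ge0 (hf n).2.
- exact: cvg_cst.
- apply: cvg_EFin; first exact: nearW.
  exact: cvg_harmonic.
Qed.

Lemma in_HV_meas w : in_HV V w -> hv_meas w.
Proof. by move=> /in_HVP[]. Qed.

Lemma hv_of_lty f : test_fun f -> (normV2 V (hv_of f) < +oo)%E.
Proof.
move=> tf; have [cf cf1 cf2] := test_fun_continuous tf.
have [rho [_ hrho]] := test_fun_support tf.
rewrite normV2E; apply: (@integral_compact_support_lty _ _ rho).
- move=> x; apply: cvgD.
    by apply: cvgD; apply: cvgM; [exact: cf1|exact: cf1|exact: cf2|exact: cf2].
  by apply: cvgM; [exact: Vc|apply: cvgM; exact: cf].
- exact: hv_density_ge0.
- by move=> x /hrho[fx f1x f2x]; rewrite /hv_density/= fx f1x f2x !mulr0 !addr0.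
Qed.

Lemma in_HV_test f : test_fun f -> in_HV V (hv_of f).
Proof.
move=> tf; apply/in_HVP; split; first exact: hv_of_meas.
move=> e e0; exists f; split => //.
rewrite subrr normV2E; under eq_integral do rewrite /hv_density/= !mulr0 !addr0.
by rewrite integral0 lee_fin ltW.
Qed.

Lemma in_HV_lty w : in_HV V w -> (normV2 V w < +oo)%E.
Proof.
move=> /in_HVP[mw h]; have [f [tf fw]] := h 1 ltr01.
have mf := hv_of_meas tf.
have -> : w = (-1) *: (hv_of f - w) + hv_of f by rewrite scaleN1r opprB subrK.
apply: le_lt_trans (normV2_lin_le _ (hv_measB mf mw) mf) _.
apply: lte_add_pinfty; last by rewrite lte_mul_pinfty// hv_of_lty.
apply: lte_mul_pinfty => //; first by rewrite lee_fin mulr_ge0// sqr_ge0.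
exact: le_lt_trans fw (ltry _).
Qed.

Lemma in_HV_lin k a b : in_HV V a -> in_HV V b -> in_HV V (k *: a + b).
Proof.
move=> /in_HVP[ma ha] /in_HVP[mb hb]; apply/in_HVP; split; first exact: hv_meas_lin.
move=> e e0.
(* With this precision for [a], the term 2 k^2 * d stays below e / 2; the added 1 covers k = 0. *)
have d0 : 0 < e / (4 * (k ^+ 2 + 1)).
  by rewrite divr_gt0// mulr_gt0// ltr_wpDl// sqr_ge0.
have e4 : 0 < e / 4 by rewrite divr_gt0.
have [f [tf fa]] := ha _ d0; have [g [tg gb]] := hb _ e4.
exists (fun x => k * f x + g x); split; first exact: test_fun_lin.
have -> : hv_of (fun x => k * f x + g x) - (k *: a + b) =
    k *: (hv_of f - a) + (hv_of g - b).
  have E : hv_of (fun x => k * f x + g x) = k *: hv_of f + hv_of g.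
    apply: hvP => x //=.
      by have := congr1 (fun F => F x) (iterD_lin [:: true] k tf.1 tg.1).
    by have := congr1 (fun F => F x) (iterD_lin [:: false] k tf.1 tg.1).
  by rewrite E scalerBr opprD addrACA.
apply: le_trans (normV2_lin_le _ (hv_measB (hv_of_meas tf) ma)
  (hv_measB (hv_of_meas tg) mb)) _.
apply: (@le_trans _ _ ((2 * k ^+ 2)%:E * (e / (4 * (k ^+ 2 + 1)))%:E
    + 2%:E * (e / 4)%:E)%E).
  by apply: leeD; apply: lee_wpmul2l => //; rewrite lee_fin mulr_ge0// sqr_ge0.
rewrite -!EFinM -EFinD lee_fin.
have k1 : 0 < k ^+ 2 + 1 by rewrite ltr_wpDl// sqr_ge0.
have -> : 2 * k ^+ 2 * (e / (4 * (k ^+ 2 + 1))) + 2 * (e / 4)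
    = e - e / (2 * (k ^+ 2 + 1)) by field; rewrite gt_eqF.
by rewrite lerBlDr lerDl ltW// divr_gt0// mulr_gt0.
Qed.

Lemma hv_density_integrable a b : in_HV V a -> in_HV V b ->
  lambda2.-integrable setT (EFin \o hv_density a b).
Proof.
move=> Ha Hb; have ma := in_HV_meas Ha; have mb := in_HV_meas Hb.
have mab : measurable_fun setT (fun x => hv_density a a x + hv_density b b x).
  by apply: measurable_funD; exact: measurable_hv_density.
have ab0 x : 0 <= hv_density a a x + hv_density b b x.
  by rewrite addr_ge0// hv_density_ge0.
have iab : lambda2.-integrable setT
    (EFin \o (fun x => hv_density a a x + hv_density b b x)).
  apply/integrableP; split; first exact/measurable_EFinP.
  under eq_integral do rewrite gee0_abs ?lee_fin ?ab0//.
  apply: (@le_lt_trans _ _ (1%:E * normV2 V a + 1%:E * normV2 V b)%E).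
    rewrite !normV2E; apply: ge0_integral_le_comb => //;
      try by [exact: measurable_hv_density|move=> x _; exact: hv_density_ge0].
    by move=> x _; rewrite !mul1r.
  by rewrite !mul1e lte_add_pinfty// in_HV_lty.
apply: le_integrable iab => //.
  by apply/measurable_EFinP; exact: measurable_hv_density.
move=> x _; rewrite lee_fin [leRHS]ger0_norm// /hv_density.
have h (s t : R) : `|s * t| <= s * s + t * t.
  by rewrite ler_norml; apply/andP; split;
    have := sqr_ge0 (s - t); have := sqr_ge0 (s + t); nra.
have h3 := ler_wpM2l (V0' x) (h (hv_u a x) (hv_u b x)).
rewrite -{1}(ger0_norm (V0' x)) -normrM in h3.
have h1 := h (hv_g1 a x) (hv_g1 b x); have h2 := h (hv_g2 a x) (hv_g2 b x).
rewrite (le_trans (ler_normD _ _))// (le_trans (lerD (ler_normD _ _) (lexx _)))//.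
lra.
Qed.

Lemma normV2_inner a : in_HV V a -> normV2 V a = (hv_inner a a)%:E.
Proof.
move=> Ha; rewrite /hv_inner /Rintegral fineK -?normV2E//.
by rewrite ge0_fin_numE ?normV2_ge0// in_HV_lty.
Qed.

Lemma normV_inner a : in_HV V a -> normV V a = Num.sqrt (hv_inner a a).
Proof. by move=> Ha; rewrite /normV normV2_inner. Qed.

Lemma semi_inner_HV : semi_inner HVset hv_inner.
Proof.
split.
- split; last by move=> k a b; exact: in_HV_lin.
  have -> : 0 = hv_of (fun=> 0) :> hv R.
    by apply: hvP => x //=; rewrite /d1 /d2 derive_cst.
  exact/in_HV_test/test_fun0.
- by move=> a b _ _; apply: eq_Rintegral => x _; rewrite /hv_density; ring.
- move=> c Hc k a b Ha Hb.
  have i1 := hv_density_integrable Ha Hc; have i2 := hv_density_integrable Hb Hc.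
  rewrite /hv_inner -RintegralZl// -RintegralD//; last first.
    exact: (@integrableZl _ _ _ _ _ _ k _ i1).
  by apply: eq_Rintegral => x _; rewrite /hv_density/=; ring.
- move=> a Ha; rewrite -lee_fin -normV2_inner//; exact: normV2_ge0.
Qed.

End weighted_sobolev_space.

(** * Completeness *)

Section weighted_sobolev_complete.
Context (R : realType) (V : R * R -> R).
Hypothesis Vc : continuous V.
Hypothesis V0 : forall x, 0 < V x.
Local Notation lambda2 := (@leb2 R).
Local Notation HVset := (in_HV V : set (hv R)).
Implicit Types (a b c w : hv R).

Let mV : measurable_fun setT V := continuous_measurable_plane Vc.
Let V0' x : 0 <= V x := ltW (V0 x).

Let sqV x := Num.sqrt (V x).

Lemma continuous_sqrtV : continuous sqV.
Proof. by move=> x; apply: continuous_comp; [exact: Vc|exact: sqrt_continuous]. Qed.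

Lemma sqrtV_gt0 x : 0 < sqV x. Proof. by rewrite sqrtr_gt0. Qed.

Lemma measurable_sqrtV : measurable_fun setT sqV.
Proof. by apply: continuous_measurable_plane; exact: continuous_sqrtV. Qed.

Lemma measurable_inv_sqrtV : measurable_fun setT (fun x => (sqV x)^-1).
Proof.
apply: continuous_measurable_plane => x; apply: cvgV; last exact: continuous_sqrtV.
by rewrite gt_eqF// sqrtV_gt0.
Qed.

(** The map w -> (g1, g2, sqrt V * u) turns [normV2] into the squared norm of three unweighted
    copies of L^2; completeness and almost everywhere convergence are taken from there. *)
Lemma normV2_components_le w : hv_meas w ->
  [/\ (\int[lambda2]_x (hv_g1 w x ^+ 2)%:E <= normV2 V w)%E,
      (\int[lambda2]_x (hv_g2 w x ^+ 2)%:E <= normV2 V w)%E &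
      (\int[lambda2]_x ((sqV x * hv_u w x) ^+ 2)%:E <= normV2 V w)%E].
Proof.
move=> mw; have md := measurable_hv_density Vc mw mw.
have msq := measurable_sqrtV.
have := mw => -[? ? ?]; rewrite normV2E; split; apply: ge0_le_integral => //;
  try (by move=> x _; rewrite lee_fin ?sqr_ge0 ?hv_density_ge0);
  try (by apply/measurable_EFinP; solve_measurable);
  move=> x _; rewrite lee_fin /hv_density -!expr2.
- by rewrite -addrA lerDl addr_ge0 ?sqr_ge0// mulr_ge0 ?sqr_ge0.
- by rewrite addrAC lerDr addr_ge0 ?sqr_ge0// mulr_ge0 ?sqr_ge0.
- by rewrite exprMn sqr_sqrtr// lerDr addr_ge0 ?sqr_ge0.
Qed.

Lemma normV2_le_components w : hv_meas w ->
  (normV2 V w <= \int[lambda2]_x (hv_g1 w x ^+ 2)%:E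
    + \int[lambda2]_x (hv_g2 w x ^+ 2)%:E
    + \int[lambda2]_x ((sqV x * hv_u w x) ^+ 2)%:E)%E.
Proof.
move=> mw; have := mw => -[mu m1 m2].
have msq := measurable_sqrtV.
have m12 : measurable_fun setT (fun x => hv_g1 w x ^+ 2 + hv_g2 w x ^+ 2).
  by solve_measurable.
have m3 : measurable_fun setT (fun x => (sqV x * hv_u w x) ^+ 2).
  by solve_measurable.
have g12 x : 0 <= hv_g1 w x ^+ 2 + hv_g2 w x ^+ 2 by rewrite addr_ge0 ?sqr_ge0.
rewrite normV2E.
apply: (@le_trans _ _ (1%:E * \int[lambda2]_x (hv_g1 w x ^+ 2 + hv_g2 w x ^+ 2)%:E
    + 1%:E * \int[lambda2]_x ((sqV x * hv_u w x) ^+ 2)%:E)%E).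
  apply: ge0_integral_le_comb => //.
  - exact: measurable_hv_density.
  - by move=> x _; exact: hv_density_ge0.
  - by move=> x _; exact: sqr_ge0.
  - by move=> x _; rewrite !mul1r exprMn sqr_sqrtr// /hv_density !expr2.
rewrite !mul1e; apply: leeD => //.
rewrite -[X in (_ <= X + _)%E]mul1e -[X in (_ <= _ + X)%E]mul1e.
apply: ge0_integral_le_comb => //; try by [move=> x _; exact: sqr_ge0|solve_measurable].
by move=> x _; rewrite !mul1r.
Qed.

Lemma four_quarters (e : R) : e%:E = (2%:E * (e / 4)%:E + 2%:E * (e / 4)%:E)%E.
Proof. by rewrite -!EFinM -EFinD; congr (_%:E); field. Qed.

(** Along a subsequence with steps at most 8^-k the three components converge in L^2, each with
    squared error 8 * 4^-k, whence the constant 24; division by sqrt V recovers the function. The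
    limit lies in the space because some [w N] is close both to it and to a test function. *)
Lemma complete_HV : complete_for HVset (hv_inner V).
Proof.
move=> w Hw cw.
have mw n := in_HV_meas V0 (Hw n).
have HB m n : in_HV V (w m - w n).
  by apply: submodule_sub => //; case: (semi_inner_HV Vc V0).
have [phi [phi_incr hphi]] : exists phi : nat -> nat,
    {homo phi : m n / (m < n)%N >-> (m < n)%N} /\ forall k m, (phi k <= m)%N ->
    (normV2 V (w m - w (phi k))%R <= (8^-1 ^+ k)%:E)%E.
  apply: (@exists_subsequence (fun k n => forall m, (n <= m)%N ->
    (normV2 V (w m - w n)%R <= (8^-1 ^+ k)%:E)%E)) => k N.
  have e0 : 0 < 8^-1 ^+ k :> R by rewrite exprn_gt0.
  have [M hM] := cw _ e0.
  exists (maxn N M); split; first exact: leq_maxl.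
  move=> m; rewrite geq_max => /andP[_ Mm].
  by rewrite (normV2_inner Vc)// lee_fin hM// leq_maxr.
pose s k := w (phi k).
have ms k : hv_meas (s k) by exact: mw.
have stepk k : (normV2 V (s k.+1 - s k)%R <= (8^-1 ^+ k)%:E)%E.
  by apply: hphi; apply/ltnW/phi_incr.
have comp k := normV2_components_le (hv_measB (ms k.+1) (ms k)).
have [g1 [mg1 hg1]] : exists g : R * R -> R, measurable_fun setT g /\
    forall k, (\int[lambda2]_x ((hv_g1 (s k) x - g x) ^+ 2)%:E <= (8 * 4^-1 ^+ k)%:E)%E.
  apply: (@L2_fast_complete _ _ _ lambda2 (fun k => hv_g1 (s k))).
    by move=> k; case: (ms k).
  move=> k; apply: le_trans (stepk k); case: (comp k) => h _ _; apply: le_trans h.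
  by under [leRHS]eq_integral do rewrite hv_g1B.
have [g2 [mg2 hg2]] : exists g : R * R -> R, measurable_fun setT g /\
    forall k, (\int[lambda2]_x ((hv_g2 (s k) x - g x) ^+ 2)%:E <= (8 * 4^-1 ^+ k)%:E)%E.
  apply: (@L2_fast_complete _ _ _ lambda2 (fun k => hv_g2 (s k))).
    by move=> k; case: (ms k).
  move=> k; apply: le_trans (stepk k); case: (comp k) => _ h _; apply: le_trans h.
  by under [leRHS]eq_integral do rewrite hv_g2B.
have [h [mh hh]] : exists g : R * R -> R, measurable_fun setT g /\
    forall k, (\int[lambda2]_x ((sqV x * hv_u (s k) x - g x) ^+ 2)%:E <= (8 * 4^-1 ^+ k)%:E)%E.
  apply: (@L2_fast_complete _ _ _ lambda2 (fun k x => sqV x * hv_u (s k) x)).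
    by move=> k; apply: measurable_funM; [exact: measurable_sqrtV|case: (ms k)].
  move=> k; apply: le_trans (stepk k); case: (comp k) => _ _ h; apply: le_trans h.
  by under [leRHS]eq_integral do rewrite hv_uB mulrBr.
pose l := HV (fun x => (sqV x)^-1 * h x) g1 g2.
have ml : hv_meas l.
  by split => //=; apply: measurable_funM => //; exact: measurable_inv_sqrtV.
have sl k : (normV2 V (s k - l)%R <= (24 * 4^-1 ^+ k)%:E)%E.
  apply: le_trans (normV2_le_components (hv_measB (ms k) ml)) _.
  have -> : 24 * 4^-1 ^+ k = 8 * 4^-1 ^+ k + 8 * 4^-1 ^+ k + 8 * 4^-1 ^+ k :> R by ring.
  rewrite !EFinD; apply: leeD; first apply: leeD.
  - by apply: le_trans (hg1 k); under [leLHS]eq_integral do rewrite hv_g1B.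
  - by apply: le_trans (hg2 k); under [leLHS]eq_integral do rewrite hv_g2B.
  - apply: le_trans (hh k).
    by under [leLHS]eq_integral do
      rewrite hv_uB mulrBr /= mulrA divff ?gt_eqF ?sqrtV_gt0// mul1r.
have small (e : R) : 0 < e -> exists N, forall k, (N <= k)%N -> 24 * 4^-1 ^+ k <= e.
  move=> e0; have c : 24 * 4^-1 ^+ n @[n --> \oo] --> 24 * (0 : R).
    by apply: cvgMr; apply: cvg_expr; rewrite ger0_norm ?invr_ge0// invf_lt1 ?ltr1n.
  rewrite mulr0 in c; have /cvgrPdist_lt/(_ _ e0)[N _ hN] := c.
  exists N => k Nk; have := hN k Nk; rewrite /= sub0r normrN => /ltW.
  exact/le_trans/ler_norm.
have near_l (e : R) : 0 < e -> exists N, forall n, (N <= n)%N ->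
    (normV2 V (w n - l)%R <= e%:E)%E.
  move=> e0; have e4 : 0 < e / 4 by rewrite divr_gt0.
  have [N hN] := cw _ e4; have [M hM] := small _ e4.
  pose k := maxn N M.
  have kphi : (k <= phi k)%N by exact: increasing_geid.
  exists N => n Nn.
  apply: le_trans (normV2_triangle Vc V0 (mw n) (ms k) ml) _.
  rewrite (four_quarters e); apply: leeD; apply: lee_wpmul2l => //.
    rewrite (normV2_inner Vc V0 (HB n (phi k))) lee_fin; apply: hN => //.
    by rewrite (leq_trans _ kphi)// leq_maxl.
  by apply: le_trans (sl k) _; rewrite lee_fin hM// leq_maxr.
have Hl : in_HV V l.
  apply/(in_HVP V0); split => // e e0.
  have e4 : 0 < e / 4 by rewrite divr_gt0.
  have [N hN] := near_l _ e4.
  have /(in_HVP V0)[_ /(_ _ e4)[f [tf fw]]] := Hw N.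
  exists f; split => //.
  apply: le_trans (normV2_triangle Vc V0 (hv_of_meas tf) (mw N) ml) _.
  by rewrite (four_quarters e); apply: leeD; apply: lee_wpmul2l => //; exact: hN.
exists l; split => //.
have HBl n : in_HV V (w n - l).
  by apply: submodule_sub => //; case: (semi_inner_HV Vc V0).
apply/cvgrPdist_le => e e0; have [N hN] := near_l _ e0.
exists N => // n /= Nn; rewrite sub0r normrN ger0_norm.
  by rewrite -lee_fin -(normV2_inner Vc)// hN.
exact: (semi_inner_ge0 (semi_inner_HV Vc V0)).
Qed.

End weighted_sobolev_complete.

(** * Sobolev inequalities *)

Section gagliardo_nirenberg.
Context (R : realType).
Local Notation lambda := (@lebesgue_measure R).
Local Notation lambda2 := (@leb2 R).
Implicit Types (F : R * R -> R) (g : R -> R).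

Lemma compact_support_norm_le g g' (rho : R) :
  (forall x : R, is_derive x (1 : R) g (g' x)) -> continuous g' ->
  (forall x, rho < `|x| -> g x = 0) ->
  forall x, (`|g x|%:E <= \int[lambda]_s `|g' s|%:E)%E.
Proof.
move=> dg cg' supp x.
(* A point to the left of both [x] and the support, where [g] vanishes. *)
pose a := - (`|rho| + `|x| + 1).
have ga : g a = 0.
  apply: supp; rewrite normrN ger0_norm ?addr_ge0//.
  by rewrite (le_lt_trans (ler_norm _))// -addrA ltrDl ltr_wpDl.
have ax : a <= x.
  rewrite lerNl (le_trans (ler_norm _))// normrN -addrA addrCA lerDl addr_ge0//.
have := norm_increment_le ax dg cg'; rewrite ga subr0 => /le_trans; apply.
have mg' : measurable_fun setT (fun s => `|g' s|%:E).
  apply/measurable_EFinP; apply: measurableT_comp => //.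
  exact: continuous_measurable_fun.
exact: ge0_subset_integral.
Qed.

(** Along a horizontal line |F (x, y)| <= A y, and along a vertical one |F (x, y)| <= B x, so F^2 <=
    A y * B x, and the integral of this product splits. The partial derivatives enter as functions
    [F1], [F2], to be instantiated with explicit formulas. *)
Lemma gagliardo_nirenberg_plane F F1 F2 (rho : R) :
  continuous F -> continuous F1 -> continuous F2 ->
  (forall x y : R, is_derive x (1 : R) (fun s => F (s, y)) (F1 (x, y))) ->
  (forall x y : R, is_derive y (1 : R) (fun t => F (x, t)) (F2 (x, y))) ->
  (forall x : R * R, rho < `|x| -> F x = 0) ->
  (\int[lambda2]_x (F x ^+ 2)%:E <=
    \int[lambda2]_x `|F1 x|%:E * \int[lambda2]_x `|F2 x|%:E)%E.
Proof.
move=> cF cF1 cF2 dF1 dF2 supp.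
have mE (G : R * R -> R) : continuous G -> measurable_fun setT (fun x => `|G x|%:E).
  move=> cG; apply/measurable_EFinP; apply: measurableT_comp => //.
  exact: continuous_measurable_plane.
have mF2 : measurable_fun setT (fun x => (F x ^+ 2)%:E).
  by apply/measurable_EFinP; apply: measurable_funX; exact: continuous_measurable_plane.
pose A := fubini_G lambda (fun x => `|F1 x|%:E).
pose B := fubini_F lambda (fun x => `|F2 x|%:E).
have A0 y : (0 <= A y)%E by apply: integral_ge0 => s _; rewrite lee_fin.
have B0 x : (0 <= B x)%E by apply: integral_ge0 => s _; rewrite lee_fin.
have mA : measurable_fun setT A.
  by apply: measurable_fun_fubini_tonelli_G; [exact: mE|move=> x; rewrite lee_fin].
have mB : measurable_fun setT B.
  by apply: measurable_fun_fubini_tonelli_F; [exact: mE|move=> x; rewrite lee_fin].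
have FA x y : (`|F (x, y)|%:E <= A y)%E.
  apply: (@compact_support_norm_le (fun s => F (s, y)) (fun s => F1 (s, y)) rho) => //.
    exact: continuous_line1.
  by move=> s rs; apply: supp; rewrite prod_normE/= lt_max rs.
have FB x y : (`|F (x, y)|%:E <= B x)%E.
  apply: (@compact_support_norm_le (fun t => F (x, t)) (fun t => F2 (x, t)) rho) => //.
    exact: continuous_line2.
  by move=> s rs; apply: supp; rewrite prod_normE/= lt_max rs orbT.
rewrite /leb2 fubini_tonelli1//; last by move=> x; rewrite lee_fin sqr_ge0.
rewrite [X in (_ <= X * _)%E]fubini_tonelli2//; [|exact: mE].
rewrite [X in (_ <= _ * X)%E]fubini_tonelli1//; [|exact: mE].
rewrite -/A -/B muleC -ge0_integralZr//; last by apply: integral_ge0.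
apply: ge0_le_integral => //.
- by move=> x _; apply: integral_ge0 => y _; rewrite lee_fin sqr_ge0.
- by apply: measurable_fun_fubini_tonelli_F => // x; rewrite lee_fin sqr_ge0.
- by apply: emeasurable_funM.
move=> x _; rewrite -ge0_integralZl//.
apply: ge0_le_integral => //.
- by move=> y _; rewrite lee_fin sqr_ge0.
- apply/measurable_EFinP; apply: measurable_funX.
  by apply: continuous_measurable_fun; exact: continuous_line2.
- exact: emeasurable_funM.
- move=> y _; rewrite -real_normK ?num_real// expr2 EFinM.
  by apply: lee_pmul => //; rewrite lee_fin.
Qed.

End gagliardo_nirenberg.

(** * Derivative of sqrt V * f^(n+1) *)

Section sqrt_mul_exp.
Context (R : realType).

Lemma is_derive_sqrt_mul_exp (g f : R -> R) (g' f' x : R) (n : nat) : 0 < g x ->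
  is_derive x (1 : R) g g' -> is_derive x (1 : R) f f' ->
  is_derive x (1 : R) (fun s => Num.sqrt (g s) * f s ^+ n.+1)
    ((2 * Num.sqrt (g x))^-1 * g' * f x ^+ n.+1
      + Num.sqrt (g x) * (n.+1%:R * f x ^+ n * f')).
Proof.
move=> gx dg df.
have d1 : is_derive x (1 : R) (fun s => Num.sqrt (g s)) ((2 * Num.sqrt (g x))^-1 * g').
  exact: is_derive1_comp (is_derive1_sqrt gx) dg.
have d2 : is_derive x (1 : R) (fun s => f s ^+ n.+1) (n.+1%:R * f x ^+ n * f').
  have -> : (fun s => f s ^+ n.+1) = f ^+ n.+1.
    by apply/funext => s; rewrite exprfctE.
  exact: (is_derive_eq (is_deriveX n.+1 df)).
apply: (is_derive_eq (is_deriveM d1 d2)).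
rewrite /GRing.scale/=; ring.
Qed.

Lemma expr_le_sqr_even (t : R) (j n : nat) : 0 <= t -> (2 <= j <= 2 * n)%N ->
  t ^+ j <= t ^+ 2 + t ^+ (2 * n).
Proof.
move=> t0 /andP[j2 jn]; have [t1|t1] := leP t 1.
  apply: (@le_trans _ _ (t ^+ 2)); last by rewrite lerDl exprn_ge0.
  by apply: ler_wiXn2l.
apply: (@le_trans _ _ (t ^+ (2 * n))); last by rewrite lerDr exprn_ge0.
by apply: ler_weXn2l => //; exact: ltW.
Qed.

(** Here s = sqrt V, while [D] and [P] are the same partial derivative of V and of f. The first term
    is at most (C / 2) s^2 |f|^(n+1), and 2 <= n+1 <= 2n places that power between f^2 and f^(2n).
    The second is split by |q P| <= q^2 + P^2 with q = s f^n. *)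
Lemma sqrt_mul_exp_derive_bound (s f D P C : R) (n : nat) : (0 < n)%N -> 0 < s ->
  0 <= C -> `|D| <= C * (s ^+ 2 * s) ->
  `|(2 * s)^-1 * D * f ^+ n.+1 + s * (n.+1%:R * f ^+ n * P)|
    <= (C + n.+1%:R) * (P ^+ 2 + s ^+ 2 * f ^+ 2 + s ^+ 2 * f ^+ (2 * n)).
Proof.
move=> n0 s0 C0 hD.
have f2n : 0 <= f ^+ (2 * n) by rewrite exprM exprn_ge0// sqr_ge0.
have s2 : 0 <= s ^+ 2 by exact: sqr_ge0.
have P2 : 0 <= P ^+ 2 by exact: sqr_ge0.
have f2 : 0 <= f ^+ 2 by exact: sqr_ge0.
have E2 : `|f| ^+ 2 = f ^+ 2 by rewrite real_normK ?num_real.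
have fn : `|f| ^+ n.+1 <= f ^+ 2 + f ^+ (2 * n).
  have E2n : `|f| ^+ (2 * n) = f ^+ (2 * n) by rewrite exprM E2 -exprM.
  rewrite -E2 -E2n; apply: expr_le_sqr_even => //.
  by rewrite ltnS n0/= mul2n -addnn -[n.+1]addn1 leq_add2l.
have T1 : `|(2 * s)^-1 * D * f ^+ n.+1| <= C * (s ^+ 2 * (f ^+ 2 + f ^+ (2 * n))).
  rewrite !normrM normrX ger0_norm; last by rewrite invr_ge0 mulr_ge0// ltW.
  apply: (@le_trans _ _ ((2 * s)^-1 * (C * (s ^+ 2 * s)) * (f ^+ 2 + f ^+ (2 * n)))).
    have i0 : 0 <= (2 * s)^-1 by rewrite invr_ge0 mulr_ge0// ltW.
    by apply: ler_pM fn; [exact: mulr_ge0|exact: exprn_ge0|exact: ler_wpM2l].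
  have -> : (2 * s)^-1 * (C * (s ^+ 2 * s)) * (f ^+ 2 + f ^+ (2 * n))
      = 2^-1 * (C * (s ^+ 2 * (f ^+ 2 + f ^+ (2 * n)))) by field; rewrite gt_eqF.
  have Z0 : 0 <= C * (s ^+ 2 * (f ^+ 2 + f ^+ (2 * n))).
    by apply: mulr_ge0 => //; apply: mulr_ge0 => //; exact: addr_ge0.
  by apply: ler_piMl => //; rewrite invf_le1 ?ler1n.
have T2 : `|s * (n.+1%:R * f ^+ n * P)| <= n.+1%:R * (P ^+ 2 + s ^+ 2 * f ^+ (2 * n)).
  have -> : s * (n.+1%:R * f ^+ n * P) = n.+1%:R * ((s * f ^+ n) * P) by ring.
  rewrite normrM ger0_norm// ler_wpM2l//.
  have -> : s ^+ 2 * f ^+ (2 * n) = (s * f ^+ n) ^+ 2 by rewrite exprMn -exprM mulnC.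
  move: (s * f ^+ n) => q.
  by rewrite ler_norml; apply/andP; split;
    have := sqr_ge0 (q - P); have := sqr_ge0 (q + P); nra.
apply: le_trans (ler_normD _ _) _; apply: le_trans (lerD T1 T2) _.
have n1 : 0 <= n.+1%:R :> R by [].
have := mulr_ge0 C0 P2; have := mulr_ge0 n1 (mulr_ge0 s2 f2).
move: (n.+1%:R) => N; nra.
Qed.

End sqrt_mul_exp.

Lemma continuous_expr (R : realType) (T : topologicalType) (f : T -> R) (m : nat) :
  continuous f -> continuous (fun x => f x ^+ m).
Proof.
move=> cf x; apply: (@continuous_comp _ _ _ f (fun z => z ^+ m)); first exact: cf.
exact: exprn_continuous.
Qed.

(** Fatou's lemma, in the form that carries upper bounds from test functions to their almost
    everywhere limits. *)
Lemma ae_cvg_integral_le d (T : measurableType d) (R : realType)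
    (mu : {measure set T -> \bar R}) (f : nat -> T -> R) (g : T -> R) (c : \bar R) :
  (forall k, measurable_fun setT (f k)) -> measurable_fun setT g ->
  (forall k x, 0 <= f k x) -> (forall x, 0 <= g x) ->
  {ae mu, forall x, f k x @[k --> \oo] --> g x} ->
  (forall k, (\int[mu]_x (f k x)%:E <= c)%E) -> (\int[mu]_x (g x)%:E <= c)%E.
Proof.
move=> mf mg f0 g0 fg fc.
pose F k x := (f k x)%:E.
have mF k : measurable_fun setT (F k) by exact/measurable_EFinP.
have einf_ge0 x : (0 <= limn_einf (F ^~ x))%E.
  rewrite limn_einf_lim; apply: lime_ge; first exact: is_cvg_einfs.
  by apply: nearW => n; apply: le_ereal_inf_tmp => _ [k _ <-]; rewrite lee_fin.
have meinf : measurable_fun setT (fun x => limn_einf (F ^~ x)).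
  apply: measurableT_comp; first exact: oppe_measurable.
  apply: measurable_fun_limn_esup => k.
  by apply: measurableT_comp => //; exact: oppe_measurable.
apply: (@le_trans _ _ (\int[mu]_x limn_einf (F ^~ x))%E).
  have mgE : measurable_fun setT (fun x => (g x)%:E) by exact/measurable_EFinP.
  apply: ae_ge0_le_integral => //; first by move=> x _; rewrite lee_fin.
  apply: filterS fg => x fgx _.
  have cF : F k x @[k --> \oo] --> (g x)%:E by apply: cvg_EFin => //; exact: nearW.
  rewrite is_cvg_limn_einfE; last by apply/cvg_ex; eexists; exact: cF.
  by rewrite (cvg_lim _ cF).
apply: le_trans (fatou mu measurableT mF (fun k x _ => f0 k x)) _.
rewrite limn_einf_lim; apply: lime_le; first exact: is_cvg_einfs.
by apply: nearW => n; apply: le_trans (fc n); apply: ereal_inf_lbound; exists n => /=.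
Qed.

Lemma powR_le_sqr_even (R : realType) (t q : R) (n : nat) : 0 <= t -> 2 <= q ->
  q <= (2 * n)%:R -> powR t q <= t ^+ 2 + t ^+ (2 * n).
Proof.
move=> t0 q2 qn; have [t1|t1] := leP t 1.
  apply: (@le_trans _ _ (t ^+ 2)); last by rewrite lerDl exprn_ge0.
  move: t0; rewrite le_eqVlt => /predU1P[<-|t0].
    by rewrite powR0 ?expr0n// gt_eqF// (lt_le_trans _ q2).
  by rewrite -powR_mulrn ?(ltW t0)//; apply: ger_powR => //; rewrite t0 t1.
apply: (@le_trans _ _ (t ^+ (2 * n))); last by rewrite lerDr exprn_ge0.
by rewrite -powR_mulrn//; apply: ler_powR => //; exact: ltW.
Qed.

(** The filter instance for [leb2] is found only after unfolding it to a product measure. *)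
Lemma ae_leb2S (R : realType) (P Q : R * R -> Prop) : (forall x, P x -> Q x) ->
  {ae @leb2 R, forall x, P x} -> {ae @leb2 R, forall x, Q x}.
Proof.
have F : Filter (almost_everywhere (@leb2 R)) by rewrite /leb2; typeclasses eauto.
exact: (@filterS _ _ F).
Qed.

(** * Weighted power bounds *)

Section sobolev_embedding.
Context (R : realType) (V : R * R -> R) (C : R).
Hypothesis hV1 : C1 V.
Hypothesis V0 : forall x, 0 < V x.
Hypothesis hC : 0 < C.
Hypothesis hgrad :
  {ae @leb2 R, forall x, gradnorm V x <= C * powR (V x) (3 / 2)}.
Local Notation lambda2 := (@leb2 R).
Implicit Types (f : R * R -> R) (w : hv R).

Lemma C1_continuous : continuous V.
Proof. by move=> x; apply: differentiable_continuous; case: hV1. Qed.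

Let Vc := C1_continuous.
Let mV : measurable_fun setT V := continuous_measurable_plane Vc.
Let V0' x : 0 <= V x := ltW (V0 x).
Let sqV x := Num.sqrt (V x).
Let sqV0 x : 0 < sqV x. Proof. by rewrite sqrtr_gt0. Qed.
Let csqV : continuous sqV := continuous_sqrtV Vc.

Lemma grad_le_ae : {ae lambda2, forall x,
  `|d1 V x| <= C * (sqV x ^+ 2 * sqV x) /\ `|d2 V x| <= C * (sqV x ^+ 2 * sqV x)}.
Proof.
apply: ae_leb2S hgrad => x.
have -> : powR (V x) (3 / 2) = sqV x ^+ 2 * sqV x.
  rewrite (_ : 3 / 2 = 1 + 2^-1); last by field.
  by rewrite powRD ?V0 ?gt_eqF ?implybT// powRr1// powR12_sqrt// sqr_sqrtr.
move=> hg; split; apply: le_trans hg; rewrite /gradnorm -sqrtr_sqr ler_wsqrtr//.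
  by rewrite lerDl sqr_ge0.
by rewrite lerDr sqr_ge0.
Qed.

(** [G] is a partial derivative of sqrt V * f^(n+1). Taking [D] and [P] as parameters treats both
    directions at once, and the gradient condition, valid almost everywhere, is integrated here. *)
Lemma integral_sqrtV_mul_exp_derive f (D P : R * R -> R) (n : nat) : (0 < n)%N ->
  test_fun f -> continuous D -> continuous P ->
  {ae lambda2, forall x, `|D x| <= C * (sqV x ^+ 2 * sqV x)} ->
  (forall x, P x ^+ 2 <= d1 f x ^+ 2 + d2 f x ^+ 2) ->
  let G x := (2 * sqV x)^-1 * D x * f x ^+ n.+1
             + sqV x * (n.+1%:R * f x ^+ n * P x) in
  continuous G /\
  (\int[lambda2]_x `|G x|%:E <= (C + n.+1%:R)%:E * normV2 V (hv_of f)
    + (C + n.+1%:R)%:E * \int[lambda2]_x (V x * f x ^+ (2 * n))%:E)%E.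
Proof.
move=> n0 tf cD cP hD hP G.
have [cf cf1 cf2] := test_fun_continuous tf.
have cX (m : nat) : continuous (fun x => f x ^+ m) by exact: continuous_expr.
have cG : continuous G.
  move=> x; apply: cvgD; apply: cvgM => //.
  - apply: cvgM; last exact: cD.
    apply: cvgV; first by rewrite mulf_neq0// gt_eqF.
    by apply: cvgMr; exact: csqV.
  - exact: cX.
  - exact: csqV.
  - by apply: cvgM; [apply: cvgMr; exact: cX|exact: cP].
split => //.
have C0 : 0 <= C + n.+1%:R by rewrite addr_ge0// ltW.
have mf : measurable_fun setT f := continuous_measurable_plane cf.
have mdens := measurable_hv_density Vc (hv_of_meas tf) (hv_of_meas tf).
have mG : measurable_fun setT (fun x => `|G x|).
  by apply: measurableT_comp => //; exact: continuous_measurable_plane.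
have Vf0 x : 0 <= V x * f x ^+ (2 * n).
  by rewrite mulr_ge0// exprM exprn_ge0// sqr_ge0.
have mVf : measurable_fun setT (fun x => V x * f x ^+ (2 * n)) by solve_measurable.
pose H x := (C + n.+1%:R) * hv_density V (hv_of f) (hv_of f) x
  + (C + n.+1%:R) * (V x * f x ^+ (2 * n)).
have H0 x : 0 <= H x by rewrite addr_ge0// mulr_ge0// hv_density_ge0.
have mH : measurable_fun setT H by rewrite /H; solve_measurable.
apply: (@le_trans _ _ (\int[lambda2]_x (H x)%:E)%E).
  have mGE : measurable_fun setT (fun x => `|G x|%:E) by exact/measurable_EFinP.
  have mHE : measurable_fun setT (fun x => (H x)%:E) by exact/measurable_EFinP.
  apply: ae_ge0_le_integral => //.
  - by move=> x _; rewrite lee_fin.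
  - apply: ae_leb2S hD => x hDx _; rewrite lee_fin.
    apply: le_trans (sqrt_mul_exp_derive_bound (f x) (P x) n0 (sqV0 x) (ltW hC) hDx) _.
    rewrite /H -mulrDr ler_wpM2l// sqr_sqrtr// lerD2r /hv_density/= -!expr2 lerD2r.
    exact: hP.
rewrite normV2E; apply: ge0_integral_le_comb => // x _; exact: hv_density_ge0.
Qed.

Lemma power_step f (n : nat) (X : \bar R) : (0 < n)%N -> test_fun f ->
  X = ((C + n.+1%:R)%:E * normV2 V (hv_of f)
    + (C + n.+1%:R)%:E * \int[lambda2]_x (V x * f x ^+ (2 * n))%:E)%E ->
  (\int[lambda2]_x (V x * f x ^+ (2 * n.+1))%:E <= X * X)%E.
Proof.
move=> n0 tf ->.
have [cf cf1 cf2] := test_fun_continuous tf.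
have [_ [cV1 cV2]] := hV1.
have D1 : {ae lambda2, forall x, `|d1 V x| <= C * (sqV x ^+ 2 * sqV x)}.
  by apply: ae_leb2S grad_le_ae => x [].
have D2 : {ae lambda2, forall x, `|d2 V x| <= C * (sqV x ^+ 2 * sqV x)}.
  by apply: ae_leb2S grad_le_ae => x [].
have P1 x : d1 f x ^+ 2 <= d1 f x ^+ 2 + d2 f x ^+ 2 by rewrite lerDl sqr_ge0.
have P2 x : d2 f x ^+ 2 <= d1 f x ^+ 2 + d2 f x ^+ 2 by rewrite lerDr sqr_ge0.
have /= [cG1 hG1] := integral_sqrtV_mul_exp_derive n0 tf cV1 cf1 D1 P1.
have /= [cG2 hG2] := integral_sqrtV_mul_exp_derive n0 tf cV2 cf2 D2 P2.
have [rho [_ hrho]] := test_fun_support tf.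
pose F x := sqV x * f x ^+ n.+1.
have cF : continuous F.
  move=> x; apply: cvgM; first exact: csqV.
  exact: continuous_expr.
have -> : (\int[lambda2]_x (V x * f x ^+ (2 * n.+1))%:E =
    \int[lambda2]_x (F x ^+ 2)%:E)%E.
  by apply: eq_integral => x _; rewrite exprMn sqr_sqrtr// -exprM mulnC.
apply: le_trans (@gagliardo_nirenberg_plane _ F _ _ rho cF cG1 cG2 _ _ _) _.
- move=> x y; apply: is_derive_sqrt_mul_exp => //.
    by apply: is_derive_line1; apply: diff_derivable; case: hV1.
  by apply: is_derive_line1; exact: test_fun_derivable1.
- move=> x y; apply: is_derive_sqrt_mul_exp => //.
    by apply: is_derive_line2; apply: diff_derivable; case: hV1.
  by apply: is_derive_line2; exact: test_fun_derivable2.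
- by move=> x /hrho[fx _ _]; rewrite /F fx expr0n mulr0.
have nn (G : R * R -> R) : (0 <= \int[lambda2]_x `|G x|%:E)%E.
  by apply: integral_ge0 => x _; rewrite lee_fin normr_ge0.
exact: lee_pmul (nn _) (nn _) hG1 hG2.
Qed.

Lemma test_even_power_le (M : R) (n : nat) : 0 <= M -> (0 < n)%N ->
  exists A : R, 0 <= A /\ forall f, test_fun f ->
  (normV2 V (hv_of f) <= M%:E)%E ->
  (\int[lambda2]_x (V x * f x ^+ (2 * n))%:E <= A%:E * normV2 V (hv_of f))%E.
Proof.
(* The induction runs on the predecessor of the exponent index: its base case is int V f^2, which is
   part of the norm. *)
move=> M0; case: n => // n _; elim: n => [|n [A [A0 IH]]].
  exists 1; split => // f tf _; rewrite mul1e.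
  have [_ _] := normV2_components_le Vc V0 (hv_of_meas tf).
  apply: le_trans; rewrite le_eqVlt; apply/orP; left; apply/eqP.
  by apply: eq_integral => x _; rewrite muln1 exprMn sqr_sqrtr.
(* By the induction hypothesis X <= K N; then X^2 <= K^2 N^2 <= K^2 M N, which is linear in N
   again. *)
pose K := (C + n.+2%:R) * (1 + A).
have K0 : 0 <= K by apply: mulr_ge0; apply: addr_ge0 => //; exact: ltW.
exists (K * K * M); split; first by apply: mulr_ge0 => //; exact: mulr_ge0.
move=> f tf fM; have := power_step (ltn0Sn n) tf erefl; set X := (_ + _)%E.
move=> /le_trans; apply.
have N0 := normV2_ge0 V0 (hv_of f).
have Nfin : normV2 V (hv_of f) \is a fin_num.
  by rewrite ge0_fin_numE// hv_of_lty.
move: fM (IH f tf) N0 Nfin; rewrite /X; set N := normV2 V (hv_of f) => fM /(_ fM) IHf N0 Nfin.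
set a := (X in (_ + _ * X)%E) in X *.
have a0 : (0 <= a)%E.
  apply: integral_ge0 => x _.
  by rewrite lee_fin mulr_ge0// exprM exprn_ge0// sqr_ge0.
have C0 : 0 <= C + n.+2%:R by rewrite addr_ge0// ltW.
have XK : (X <= K%:E * N)%E.
  apply: (@le_trans _ _ ((C + n.+2%:R)%:E * N + (C + n.+2%:R)%:E * (A%:E * N))%E).
    by rewrite leeD2l// lee_wpmul2l// lee_fin.
  rewrite -(fineK Nfin) -!EFinM -EFinD lee_fin /K.
  by rewrite le_eqVlt; apply/orP; left; apply/eqP; ring.
have X0 : (0 <= X)%E by rewrite adde_ge0// mule_ge0// lee_fin.
apply: le_trans (lee_pmul X0 X0 XK XK) _.
move: fM N0; rewrite -(fineK Nfin) -!EFinM !lee_fin => fM N0.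
have := ler_wpM2l (mulr_ge0 (mulr_ge0 K0 K0) N0) fM.
move: (fine N) => z; lra.
Qed.

(** The approximants must not spoil linearity in N: at squared distance at most N from [w] they
    satisfy normV2 <= 2 N + 2 N = 4 N, so the bound for test functions, taken at level 4 M, yields 4
    A N. Fatou's lemma then gives the bound for [w]. *)
Lemma in_HV_even_power_le (M : R) (n : nat) : 0 <= M -> (0 < n)%N ->
  exists A : R, 0 <= A /\ forall w, in_HV V w ->
  (0 < normV2 V w)%E -> (normV2 V w <= M%:E)%E ->
  (\int[lambda2]_x (V x * hv_u w x ^+ (2 * n))%:E <= A%:E * normV2 V w)%E.
Proof.
move=> M0 n0.
have M4 : 0 <= 4 * M by rewrite mulr_ge0.
have [A [A0 hA]] := test_even_power_le M4 n0.
exists (4 * A); split; first by rewrite mulr_ge0.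
move=> w Hw; have mw := in_HV_meas V0 Hw.
rewrite (normV2_inner Vc V0 Hw) lte_fin lee_fin; set N := hv_inner V w w => N0 NM.
(* The first entry gives convergence almost everywhere, the second the bound 4 N; the radius is
   positive because N is. *)
have d0 j : 0 < Num.min (8^-1 ^+ j) N by rewrite lt_min N0 exprn_gt0.
have /(in_HVP V0)[_ happ] := Hw.
have [f hf] := choice (fun j => happ _ (d0 j)).
have tf j := (hf j).1.
have fj j : (normV2 V (hv_of (f j) - w)%R <= (8^-1 ^+ j)%:E)%E.
  by apply: le_trans (hf j).2 _; rewrite lee_fin ge_min lexx.
have fN j : (normV2 V (hv_of (f j)) <= (4 * N)%:E)%E.
  have -> : hv_of (f j) = 1 *: (hv_of (f j) - w) + w by rewrite scale1r subrK.
  apply: le_trans (normV2_lin_le Vc V0 1 (hv_measB (hv_of_meas (tf j)) mw) mw) _.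
  rewrite expr1n mulr1 (normV2_inner Vc V0 Hw) -/N.
  have -> : (4 * N)%:E = (2%:E * N%:E + 2%:E * N%:E)%E.
    by rewrite -!EFinM -EFinD; congr (_%:E); ring.
  rewrite leeD2r// lee_wpmul2l//; apply: le_trans (hf j).2 _.
  by rewrite lee_fin ge_min lexx orbT.
have msq : measurable_fun setT sqV := measurable_sqrtV Vc.
have mf j : measurable_fun setT (f j) by case: (hv_of_meas (tf j)).
have mu : measurable_fun setT (hv_u w) by case: mw.
have ev0 (z : R) : 0 <= z ^+ (2 * n) by rewrite exprM exprn_ge0// sqr_ge0.
apply: (@ae_cvg_integral_le _ _ _ lambda2 (fun j x => V x * f j x ^+ (2 * n))).
- by move=> j; have ? := mf j; solve_measurable.
- by solve_measurable.
- by move=> j x; exact: mulr_ge0.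
- by move=> x; exact: mulr_ge0.
- have H : {ae lambda2, forall x,
      sqV x * f j x @[j --> \oo] --> sqV x * hv_u w x}.
    apply: (@L2_fast_cvg_ae _ _ _ lambda2 (fun j x => sqV x * f j x)).
    + by move=> j; have ? := mf j; solve_measurable.
    + by solve_measurable.
    + move=> j; apply: le_trans (fj j).
      have [_ _] := normV2_components_le Vc V0 (hv_measB (hv_of_meas (tf j)) mw).
      apply: le_trans; rewrite le_eqVlt; apply/orP; left; apply/eqP.
      by apply: eq_integral => x _; rewrite hv_uB mulrBr.
  apply: ae_leb2S H => x sfx; apply: cvgMr.
  have fx : f j x @[j --> \oo] --> hv_u w x.
    have -> : hv_u w x = (sqV x)^-1 * (sqV x * hv_u w x).
      by rewrite mulrA mulVf ?mul1r// gt_eqF.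
    have : (sqV x)^-1 * (sqV x * f j x) @[j --> \oo] -->
        (sqV x)^-1 * (sqV x * hv_u w x) by apply: cvgMr.
    by under eq_cvg do rewrite mulrA mulVf ?mul1r ?gt_eqF//.
  by apply: (continuous_cvg _ (@exprn_continuous R (2 * n) _)).
- move=> j; apply: le_trans (hA _ (tf j) _) _.
    by apply: le_trans (fN j) _; rewrite lee_fin ler_wpM2l.
  have -> : ((4 * A)%:E * N%:E = A%:E * (4 * N)%:E)%E.
    by rewrite -!EFinM; congr (_%:E); ring.
  by rewrite lee_wpmul2l// lee_fin.
Qed.

(** The real exponent lies between 2 and 2n for n = truncn (p + 1) + 1, so |u|^(p+1) <= u^2 +
    u^(2n). The summand 1 of the constant pays for V u^2. *)
Lemma Vpow_le (M p : R) : 0 <= M -> 1 <= p -> exists A : R, 0 <= A /\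
  forall w, in_HV V w -> (0 < normV2 V w)%E -> (normV2 V w <= M%:E)%E ->
  (Vpow V p w <= A%:E * normV2 V w)%E.
Proof.
move=> M0 p1.
pose n := (Num.truncn (p + 1)).+1.
have [A [A0 hA]] := @in_HV_even_power_le M n M0 isT.
exists (1 + A); split; first by rewrite addr_ge0.
move=> w Hw N0 NM; have mw := in_HV_meas V0 Hw.
have mu : measurable_fun setT (hv_u w) by case: mw.
have ev0 (z : R) : 0 <= z ^+ (2 * n) by rewrite exprM exprn_ge0// sqr_ge0.
have mnu : measurable_fun setT (fun x => powR `|hv_u w x| (p + 1)).
  apply: (@measurableT_comp _ _ _ _ _ _ (fun t : R => powR t (p + 1)) _
    (fun x => `|hv_u w x|)); first exact: measurable_powR.
  by apply: measurableT_comp.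
have pn : p + 1 <= (2 * n)%:R.
  apply: (@le_trans _ _ n%:R); first by apply/ltW; exact: truncnS_gt.
  by rewrite ler_nat leq_pmull.
rewrite EFinD ge0_muleDl// mul1e.
apply: (@le_trans _ _ (1%:E * normV2 V w
    + 1%:E * \int[lambda2]_x (V x * hv_u w x ^+ (2 * n))%:E)%E); last first.
  by rewrite !mul1e leeD2l// hA.
rewrite normV2E; apply: ge0_integral_le_comb => //.
- by solve_measurable.
- exact: measurable_hv_density.
- by solve_measurable.
- by move=> x _; rewrite mulr_ge0// powR_ge0.
- by move=> x _; exact: hv_density_ge0.
- by move=> x _; rewrite mulr_ge0.
- move=> x _; rewrite !mul1r.
  have p2 : 2 <= p + 1 by rewrite -[2]/(1 + 1) lerD2r.
  have := powR_le_sqr_even (normr_ge0 (hv_u w x)) p2 pn.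
  rewrite exprM real_normK ?num_real// -exprM => /(ler_wpM2l (V0' x)) h.
  apply: le_trans h _; rewrite mulrDr lerD2r /hv_density -!expr2 lerDr.
  by rewrite addr_ge0// sqr_ge0.
Qed.

End sobolev_embedding.

(** * Poincare inequality and compactness *)

Section poincare.
Context (R : realType).
Local Notation lambda := (@lebesgue_measure R).
Local Notation lambda2 := (@leb2 R).
Implicit Types (f F : R * R -> R) (I J : set R) (G : R * R -> \bar R) (a b c h : R).

Lemma tonelli_box1 I J G : measurable I -> measurable J ->
  measurable_fun setT G -> (forall x, 0 <= G x)%E ->
  (\int[lambda2]_(z in I `*` J) G z
    = \int[lambda]_(x in I) \int[lambda]_(y in J) G (x, y))%E.
Proof.
move=> mI mJ mG G0.
have mIJ : measurable (I `*` J) by exact: measurableX.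
rewrite integral_mkcond /leb2 fubini_tonelli1/=; first last.
- by move=> z; rewrite patchE; case: ifPn.
- by apply/(measurable_restrictT _ mIJ); exact: measurable_funTS.
rewrite [RHS]integral_mkcond; apply: eq_integral => x _.
rewrite /fubini_F patchE; case: ifPn => xI.
  rewrite [RHS]integral_mkcond; apply: eq_integral => y _.
  rewrite !patchE; congr (if _ then _ else _).
  by rewrite in_setX/= xI.
apply: integral0_eq => y _; rewrite patchE ifF//.
by rewrite in_setX/= (negbTE xI).
Qed.

Lemma tonelli_box2 I J G : measurable I -> measurable J ->
  measurable_fun setT G -> (forall x, 0 <= G x)%E ->
  (\int[lambda2]_(z in I `*` J) G z
    = \int[lambda]_(y in J) \int[lambda]_(x in I) G (x, y))%E.
Proof.
move=> mI mJ mG G0.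
have mIJ : measurable (I `*` J) by exact: measurableX.
rewrite integral_mkcond /leb2 fubini_tonelli2/=; first last.
- by move=> z; rewrite patchE; case: ifPn.
- by apply/(measurable_restrictT _ mIJ); exact: measurable_funTS.
rewrite [RHS]integral_mkcond; apply: eq_integral => y _.
rewrite /fubini_G patchE; case: ifPn => yJ.
  rewrite [RHS]integral_mkcond; apply: eq_integral => x _.
  rewrite !patchE; congr (if _ then _ else _).
  by rewrite in_setX/= yJ andbT.
apply: integral0_eq => x _; rewrite patchE ifF//.
by rewrite in_setX/= (negbTE yJ) andbF.
Qed.

Lemma measurable_section_integral1 J G : measurable J -> measurable_fun setT G ->
  (forall x, 0 <= G x)%E ->
  measurable_fun setT (fun x : R => \int[lambda]_(y in J) G (x, y))%E.
Proof.
move=> mJ mG G0.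
have mTJ : measurable (setT `*` J : set (R * R)) by exact: measurableX.
have -> : (fun x : R => \int[lambda]_(y in J) G (x, y))%E
    = fubini_F lambda (G \_ (setT `*` J)).
  apply/funext => x; rewrite /fubini_F [LHS]integral_mkcond; apply: eq_integral => y _.
  by rewrite !patchE in_setX in_setT.
apply: measurable_fun_fubini_tonelli_F.
  by apply/(measurable_restrictT _ mTJ); exact: measurable_funTS.
by move=> z; rewrite patchE; case: ifPn.
Qed.

Lemma measurable_section_integral2 I G : measurable I -> measurable_fun setT G ->
  (forall x, 0 <= G x)%E ->
  measurable_fun setT (fun y : R => \int[lambda]_(x in I) G (x, y))%E.
Proof.
move=> mI mG G0.
have mIT : measurable (I `*` setT : set (R * R)) by exact: measurableX.
have -> : (fun y : R => \int[lambda]_(x in I) G (x, y))%E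
    = fubini_G lambda (G \_ (I `*` setT)).
  apply/funext => y; rewrite /fubini_G [LHS]integral_mkcond; apply: eq_integral => x _.
  by rewrite !patchE in_setX in_setT andbT.
apply: measurable_fun_fubini_tonelli_G.
  by apply/(measurable_restrictT _ mIT); exact: measurable_funTS.
by move=> z; rewrite patchE; case: ifPn.
Qed.

(** Half-open, so that a square is the disjoint union of its four quarters. *)
Definition square a c h : set (R * R) :=
  `[a, a + h[%classic `*` `[c, c + h[%classic.

Lemma measurable_square a c h : measurable (square a c h).
Proof. by apply: measurableX; exact: measurable_itv. Qed.

Lemma lebesgue_itvco a h : 0 < h -> lambda `[a, a + h[%classic = h%:E.
Proof.
move=> h0; rewrite lebesgue_measure_itv/= lte_fin ltrDl h0 -EFinD.
by congr (_%:E); ring.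
Qed.

Lemma leb2_square a c h : 0 < h -> lambda2 (square a c h) = (h ^+ 2)%:E.
Proof.
move=> h0.
have -> : lambda2 (square a c h) =
    (lambda `[a, (a + h)%R[%classic * lambda `[c, (c + h)%R[%classic)%E.
  by apply: product_measure1E; exact: measurable_itv.
by rewrite !lebesgue_itvco// -EFinM.
Qed.

Lemma integrable_compact_support f rho : continuous f ->
  (forall x : R * R, rho < `|x| -> f x = 0) ->
  lambda2.-integrable setT (EFin \o f).
Proof.
move=> cf fsupp; apply/integrableP; split.
  by apply/measurable_EFinP; exact: continuous_measurable_plane.
apply: (@integral_compact_support_lty _ (fun x => `|f x|) rho) => //.
  by move=> x; apply: cvg_norm; exact: cf.
by move=> x /fsupp ->; rewrite normr0.
Qed.

Lemma sqr_increment_itvco_le (g g' : R -> R) a h x y : 0 < h ->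
  (forall x : R, is_derive x (1 : R) g (g' x)) -> continuous g' ->
  x \in `[a, a + h[ -> y \in `[a, a + h[ ->
  (((g x - g y) ^+ 2)%:E <= h%:E * \int[lambda]_(s in `[a, (a + h)%R[) (g' s ^+ 2)%:E)%E.
Proof.
move=> h0 dg cg'; rewrite !in_itv/=.
wlog : x y / y <= x => [H|].
  have [yx|/ltW xy] := leP y x; first exact: H.
  by move=> hx hy; rewrite -opprB sqrrN; exact: H.
move=> yx /andP[ax xh] /andP[ay yh].
apply: le_trans (sqr_increment_le yx dg cg') _.
have mg : measurable_fun setT (fun s => (g' s ^+ 2)%:E).
  by apply/measurable_EFinP; apply: measurable_funX; exact: continuous_measurable_fun.
apply: lee_pmul.
- by rewrite lee_fin subr_ge0.
- by apply: integral_ge0 => s _; rewrite lee_fin sqr_ge0.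
- by rewrite lee_fin; lra.
- apply: ge0_subset_integral => //.
  + exact: measurable_funTS.
  + by move=> s _; rewrite lee_fin sqr_ge0.
  + move=> s /=; rewrite !in_itv/= => /andP[ys sx].
    by rewrite (le_trans ay ys) (le_lt_trans sx xh).
Qed.

(** Evaluates int (f - k)^2 in the Poincare inequality and int (t u + 1)^2 in the Cauchy-Schwarz
    inequality on a square. *)
Lemma square_quadratic_integral f a c h (k l m : R) : 0 < h ->
  lambda2.-integrable (square a c h) (EFin \o f) ->
  lambda2.-integrable (square a c h) (EFin \o (fun z => f z ^+ 2)) ->
  (\int[lambda2]_(z in square a c h) (k * f z ^+ 2 + l * f z + m)%:E
   = (k * \int[lambda2]_(z in square a c h) (f z ^+ 2)
     + l * \int[lambda2]_(z in square a c h) f z + m * h ^+ 2)%:E)%E.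
Proof.
move=> h0 if1 if2; set q := square a c h.
have mq : measurable q by exact: measurable_square.
have ik : lambda2.-integrable q (EFin \o (fun z => k * f z ^+ 2)).
  exact: (@integrableZl _ _ _ _ _ _ k _ if2).
have il : lambda2.-integrable q (EFin \o (fun z => l * f z)).
  exact: (@integrableZl _ _ _ _ _ _ l _ if1).
have ikl : lambda2.-integrable q (EFin \o (fun z => k * f z ^+ 2 + l * f z)).
  exact: integrableD ik il.
have im : lambda2.-integrable q (EFin \o (fun _ : R * R => m)).
  apply/integrableP; split; first exact/measurable_EFinP/measurable_cst.
  rewrite /= integral_cst//.
  rewrite [X in (_ * X)%E](_ : _ = (h ^+ 2)%:E) ?ltry//; exact: leb2_square.
under eq_integral do rewrite EFinD.
rewrite integralD//=.
under eq_integral do rewrite EFinD.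
rewrite integralD//=.
under eq_integral do rewrite EFinM.
rewrite integralZl//.
under [X in (_ + X + _)%E]eq_integral do rewrite EFinM.
rewrite integralZl// integral_cst//.
rewrite [X in (_ + _ + _ * X)%E](_ : _ = (h ^+ 2)%:E); last exact: leb2_square.
rewrite /Rintegral !EFinD !EFinM !fineK//; exact: integrable_fin_num.
Qed.

(* The mean of [f] is its best constant approximation in [L^2]; it is compared
   with the value at a corner of a vertical line on which the integral of
   [d2 f ^+ 2] does not exceed its average. *)
Lemma poincare_square f a c h : test_fun f -> 0 < h ->
  (\int[lambda2]_(z in square a c h) (f z ^+ 2)%:E <=
   (h ^- 2 * (\int[lambda2]_(z in square a c h) f z) ^+ 2)%:E
   + (2 * h ^+ 2)%:E
     * \int[lambda2]_(z in square a c h) (d1 f z ^+ 2 + d2 f z ^+ 2)%:E)%E.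
Proof.
move=> tf h0; have [cf cf1 cf2] := test_fun_continuous tf.
have [rho [_ hrho]] := test_fun_support tf.
pose I : set R := `[a, a + h[%classic; pose J : set R := `[c, c + h[%classic.
set q := square a c h.
have mI : measurable I by exact: measurable_itv.
have mJ : measurable J by exact: measurable_itv.
have mq : measurable q by exact: measurable_square.
have isq (g : R * R -> R) : continuous g -> (forall x : R * R, rho < `|x| -> g x = 0) ->
    lambda2.-integrable q (EFin \o g).
  move=> cg hg; apply: (@integrableS _ _ _ _ setT) => //.
  exact: integrable_compact_support cg hg.
have csq (g : R * R -> R) : continuous g -> continuous (fun z => g z ^+ 2).
  exact: continuous_expr.
have if1 : lambda2.-integrable q (EFin \o f) by apply: isq => // x /hrho[].
have if2 : lambda2.-integrable q (EFin \o (fun z => f z ^+ 2)).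
  by apply: isq; [exact: csq|move=> x /hrho[-> _ _]; rewrite expr0n].
have id1 : lambda2.-integrable q (EFin \o (fun z => d1 f z ^+ 2)).
  by apply: isq; [exact: csq|move=> x /hrho[_ -> _]; rewrite expr0n].
have id2 : lambda2.-integrable q (EFin \o (fun z => d2 f z ^+ 2)).
  by apply: isq; [exact: csq|move=> x /hrho[_ _ ->]; rewrite expr0n].
have msq (g : R * R -> R) : continuous g -> measurable_fun setT (fun z => (g z ^+ 2)%:E).
  by move=> cg; apply/measurable_EFinP; apply: continuous_measurable_plane; exact: csq.
have sq0 (g : R * R -> R) (z : R * R) : (0 <= (g z ^+ 2)%:E)%E by rewrite lee_fin sqr_ge0.
pose A (t : R) := (\int[lambda]_(s in I) (d1 f (s, t) ^+ 2)%:E)%E.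
pose B (s : R) := (\int[lambda]_(t in J) (d2 f (s, t) ^+ 2)%:E)%E.
have A0 t : (0 <= A t)%E by apply: integral_ge0 => s _; exact: (sq0 (d1 f) (s, t)).
have B0 s : (0 <= B s)%E by apply: integral_ge0 => t _; exact: (sq0 (d2 f) (s, t)).
have mA : measurable_fun setT A.
  by apply: (@measurable_section_integral2 I (fun z => (d1 f z ^+ 2)%:E)) => //; exact: msq.
have mB : measurable_fun setT B.
  by apply: (@measurable_section_integral1 J (fun z => (d2 f z ^+ 2)%:E)) => //; exact: msq.
have incA x x' y : x \in `[a, a + h[ -> x' \in `[a, a + h[ ->
    (((f (x, y) - f (x', y)) ^+ 2)%:E <= h%:E * A y)%E.
  move=> xI x'I.
  apply: (@sqr_increment_itvco_le (fun s => f (s, y)) (fun s => d1 f (s, y))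
    a h x x' h0 _ _ xI x'I).
    by move=> s; apply: is_derive_line1; exact: test_fun_derivable1.
  exact: continuous_line1.
have incB x y y' : y \in `[c, c + h[ -> y' \in `[c, c + h[ ->
    (((f (x, y) - f (x, y')) ^+ 2)%:E <= h%:E * B x)%E.
  move=> yJ y'J.
  apply: (@sqr_increment_itvco_le (fun t => f (x, t)) (fun t => d2 f (x, t))
    c h y y' h0 _ _ yJ y'J).
    by move=> s; apply: is_derive_line2; exact: test_fun_derivable2.
  exact: continuous_line2.
have fineE (g : R * R -> R) : lambda2.-integrable q (EFin \o g) ->
    (\int[lambda2]_(z in q) (g z)%:E)%E = (\int[lambda2]_(z in q) g z)%:E.
  by move=> ig; rewrite /Rintegral fineK//; exact: integrable_fin_num ig.
pose D1 := (\int[lambda2]_(z in q) (d1 f z ^+ 2))%R.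
pose D2 := (\int[lambda2]_(z in q) (d2 f z ^+ 2))%R.
have D1E : (\int[lambda2]_(z in q) (d1 f z ^+ 2)%:E)%E = D1%:E.
  exact: fineE id1.
have D2E : (\int[lambda2]_(z in q) (d2 f z ^+ 2)%:E)%E = D2%:E.
  exact: fineE id2.
have intA : (\int[lambda]_(t in J) A t)%E = D1%:E.
  by rewrite -D1E (@tonelli_box2 I J (fun z => (d1 f z ^+ 2)%:E))//; exact: msq.
have intB : (\int[lambda]_(s in I) B s)%E = D2%:E.
  by rewrite -D2E (@tonelli_box1 I J (fun z => (d2 f z ^+ 2)%:E))//; exact: msq.
have lI : lambda I = h%:E by exact: lebesgue_itvco.
have lJ : lambda J = h%:E by exact: lebesgue_itvco.
pose S := (\int[lambda2]_(z in q) (f z ^+ 2))%R.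
pose m := (\int[lambda2]_(z in q) f z)%R.
have SE : (\int[lambda2]_(z in q) (f z ^+ 2)%:E)%E = S%:E.
  exact: fineE if2.
have DE : (\int[lambda2]_(z in q) (d1 f z ^+ 2 + d2 f z ^+ 2)%:E)%E = (D1 + D2)%:E.
  under eq_integral do rewrite EFinD.
  by rewrite integralD// D1E D2E.
have D20 : 0 <= D2.
  by rewrite -lee_fin -D2E; apply: integral_ge0 => z _; exact: (sq0 (d2 f)).
have E k : (\int[lambda2]_(z in q) ((f z - k) ^+ 2)%:E
    = (1 * S + (- (2 * k)) * m + k ^+ 2 * h ^+ 2)%:E)%E.
  rewrite -(square_quadratic_integral _ _ _ h0 if1 if2).
  by apply: eq_integral => z _; congr (_%:E); ring.
rewrite SE DE -/m -EFinM -EFinD lee_fin.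
clear SE DE D1E D2E if1 if2 id1 id2 isq msq.
clearbody A B D1 D2 S m.
apply/ler_addgt0Pr => e e0.
(* The slack in the choice of the vertical line; it enters the final bound as 2 h^2 d = e. *)
pose d := e / (2 * h ^+ 2).
have d0 : 0 < d by rewrite divr_gt0// mulr_gt0// exprn_gt0.
(* [y1] is a first coordinate. If h * B s exceeded D2 + d for every s in [I], integration over [I]
   would give h (D2 + d) <= h D2. *)
have [y1 y1I hy1] : exists2 y1, y1 \in `[a, a + h[ & (h%:E * B y1 <= (D2 + d)%:E)%E.
  apply: contrapT => /forall2NP H.
  have : (\int[lambda]_(s in I) (D2 + d)%:E <= \int[lambda]_(s in I) (h%:E * B s))%E.
    apply: ge0_le_integral => //.
    - by move=> s _; rewrite lee_fin addr_ge0// ltW.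
    - by apply: measurable_funTS; exact: measurable_funeM.
    - move=> s sI; have [//|/negP] := H s.
      by rewrite -ltNge => /ltW.
  rewrite ge0_integralZl ?lee_fin ?(ltW h0)//; last exact: measurable_funTS.
  rewrite intB integral_cst// [X in (_ * X <= _)%E](_ : _ = h%:E)//.
  by rewrite -!EFinM lee_fin mulrC ler_pM2l// gerDl leNgt d0.
pose k := f (y1, c).
(* The path from (x, y) to (y1, c) goes horizontally to (y1, y), then vertically; (s + t)^2 <= 2 s^2
   + 2 t^2 separates the two increments. *)
have pt z : q z -> (((f z - k) ^+ 2)%:E <= (2 * h)%:E * A z.2 + (2 * h)%:E * B y1)%E.
  case: z => x y [/= xI yJ].
  have c0J : c \in `[c, c + h[ by rewrite in_itv/= lexx ltrDl h0.
  have s1 := incA x y1 y xI y1I; have s2 := incB y1 y c yJ c0J.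
  apply: (@le_trans _ _ (2%:E * ((f (x, y) - f (y1, y)) ^+ 2)%:E
      + 2%:E * ((f (y1, y) - f (y1, c)) ^+ 2)%:E)%E).
    rewrite -!EFinM -EFinD lee_fin /k.
    have := sqr_ge0 ((f (x, y) - f (y1, y)) - (f (y1, y) - f (y1, c))); nra.
  by rewrite !EFinM -!muleA; apply: leeD; apply: lee_wpmul2l.
have h20 : 0 <= 2 * h by rewrite mulr_ge0// ltW.
have mA2 : measurable_fun setT (fun z : R * R => A z.2).
  exact: measurableT_comp mA measurable_snd.
have intA2 : (\int[lambda2]_(z in q) A z.2)%E = (h * D1)%:E.
  rewrite (@tonelli_box1 I J (fun z => A z.2))//=.
  transitivity (\int[lambda]_(x in I) D1%:E)%E.
    by apply: eq_integral => x _; exact: intA.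
  by rewrite integral_cst// [X in (_ * X)%E](_ : _ = h%:E)// -EFinM mulrC.
have fk2 : (\int[lambda2]_(z in q) ((f z - k) ^+ 2)%:E
    <= (2 * h * (h * D1) + 2 * h ^+ 2 * (D2 + d))%:E)%E.
  apply: (@le_trans _ _ (\int[lambda2]_(z in q)
      ((2 * h)%:E * A z.2 + (2 * h)%:E * B y1))%E).
    apply: ge0_le_integral => //.
    - by move=> z _; rewrite lee_fin sqr_ge0.
    - apply/measurable_EFinP; apply: measurable_funTS.
      apply: measurable_funX; apply: measurable_funB => //.
      exact: continuous_measurable_plane.
    - apply: emeasurable_funD; last exact: measurable_cst.
      by apply: measurable_funTS; exact: measurable_funeM.
  rewrite ge0_integralD//; first last.
  - by move=> z _; rewrite mule_ge0.
  - by apply: measurable_funTS; exact: measurable_funeM.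
  - by move=> z _; rewrite mule_ge0.
  rewrite ge0_integralZl//; last exact: measurable_funTS.
  rewrite intA2 integral_cst//.
  rewrite [X in (_ + _ * X)%E](_ : _ = (h ^+ 2)%:E); last exact: leb2_square.
  rewrite EFinD -EFinM leeD2l//.
  have -> : ((2 * h)%:E * B y1 * (h ^+ 2)%:E = (2 * h ^+ 2)%:E * (h%:E * B y1))%E.
    by rewrite [LHS]muleAC muleA -!EFinM; congr (_%:E * _)%E; ring.
  by rewrite [leRHS]EFinM lee_wpmul2l// lee_fin mulr_ge0// sqr_ge0.
move: fk2; rewrite E lee_fin => fk2.
have de : 2 * h ^+ 2 * d = e.
  by rewrite /d; field; rewrite gt_eqF.
(* This square is the excess of int (f - k)^2 over its minimum S - m^2 / h^2 among all constants. *)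
have := sqr_ge0 (m / h - k * h).
have -> : (m / h - k * h) ^+ 2 = h ^- 2 * m ^+ 2 - 2 * k * m + k ^+ 2 * h ^+ 2.
  by field; rewrite gt_eqF.
move: (h ^- 2 * m ^+ 2) => M; nra.
Qed.

End poincare.

(** * Vanishing of L^2 norms from vanishing means *)

Section rellich.
Context (R : realType).
Local Notation lambda2 := (@leb2 R).
Implicit Types (F : R * R -> R) (a c h : R).

Lemma squareE a c h : square a c (h + h) =
  (square a c h `|` square (a + h) c h) `|`
  (square a (c + h) h `|` square (a + h) (c + h) h).
Proof.
apply/seteqP; split=> -[x y]; rewrite /square /=.
  rewrite !in_itv/= => -[/andP[ax xh] /andP[cy yh]].
  have [x1|x1] := ltP x (a + h); have [y1|y1] := ltP y (c + h);
    [left; left|right; left|left; right|right; right];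
    by split; apply/andP; split; lra.
rewrite !in_itv/=.
by move=> [[]|[]] [/andP[ax xh] /andP[cy yh]]; split; apply/andP; split; lra.
Qed.

Lemma ge0_integral_setU2 (A B : set (R * R)) F : measurable A -> measurable B ->
  measurable_fun setT F -> (forall x, 0 <= F x) -> A `&` B `<=` set0 ->
  (\int[lambda2]_(x in A `|` B) (F x)%:E
    = \int[lambda2]_(x in A) (F x)%:E + \int[lambda2]_(x in B) (F x)%:E)%E.
Proof.
move=> mA mB mF F0 AB; apply: ge0_integral_setU => //.
- by apply: measurable_funTS; exact/measurable_EFinP.
- by move=> x _; rewrite lee_fin.
- exact/disj_setPS.
Qed.

Lemma integral_squareD F a c h : 0 < h -> measurable_fun setT F ->
  (forall x, 0 <= F x) ->
  (\int[lambda2]_(x in square a c (h + h)) (F x)%:E =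
   (\int[lambda2]_(x in square a c h) (F x)%:E
     + \int[lambda2]_(x in square (a + h) c h) (F x)%:E)
   + (\int[lambda2]_(x in square a (c + h) h) (F x)%:E
     + \int[lambda2]_(x in square (a + h) (c + h) h) (F x)%:E))%E.
Proof.
move=> h0 mF F0.
have mS a' c' : measurable (square a' c' h) by exact: measurable_square.
rewrite squareE !ge0_integral_setU2//; try exact: measurableU.
- by move=> [x y]; rewrite /square/= !in_itv/=
    => -[[/andP[? ?] /andP[? ?]] [/andP[? ?] /andP[? ?]]]; lra.
- by move=> [x y]; rewrite /square/= !in_itv/=
    => -[[/andP[? ?] /andP[? ?]] [/andP[? ?] /andP[? ?]]]; lra.
- by move=> [x y]; rewrite /square/= !in_itv/=
    => -[[[/andP[? ?] /andP[? ?]]|[/andP[? ?] /andP[? ?]]]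
         [[/andP[? ?] /andP[? ?]]|[/andP[? ?] /andP[? ?]]]]; lra.
Qed.

Section vanishing_means.
Variable f : nat -> R * R -> R.
Hypothesis tf : forall n, test_fun (f n).
Hypothesis f_means : forall a c h, 0 < h ->
  (\int[lambda2]_(x in square a c h) f n x)%R @[n --> \oo] --> (0 : R).

Let grad2 n x := d1 (f n) x ^+ 2 + d2 (f n) x ^+ 2.

Lemma measurable_test_sqr n : measurable_fun setT (fun x => f n x ^+ 2).
Proof.
have [cf _ _] := test_fun_continuous (tf n).
by apply: continuous_measurable_plane; exact: continuous_expr.
Qed.

Lemma measurable_test_grad2 n : measurable_fun setT (grad2 n).
Proof.
have [_ c1 c2] := test_fun_continuous (tf n).
apply: measurable_funD; apply: continuous_measurable_plane; exact: continuous_expr.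
Qed.

(** The Poincare inequality on the 4^j subsquares of side h / 2^j, reached by repeated quartering.
    For fixed j, [eps] collects finitely many squared means and tends to 0 in n, while the gradient
    coefficient is made small by the choice of j. *)
Lemma square_sqr_integral_le (j : nat) a c h : 0 < h ->
  exists eps : nat -> R, eps n @[n --> \oo] --> (0 : R) /\
  forall n, (\int[lambda2]_(x in square a c h) (f n x ^+ 2)%:E <=
    (eps n)%:E + (2 * (h * 2^-1 ^+ j) ^+ 2)%:E
      * \int[lambda2]_(x in square a c h) (grad2 n x)%:E)%E.
Proof.
elim: j a c h => [|j IH] a c h h0.
  exists (fun n => h ^- 2 * (\int[lambda2]_(x in square a c h) f n x)%R ^+ 2).
  split; last by move=> n; rewrite expr0 mulr1; exact: poincare_square.
  rewrite -[X in _ --> X](mulr0 (h ^- 2)); apply: cvgMr.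
  by rewrite -[X in _ --> X](mulr0 (0 : R)); apply: cvgM; exact: f_means.
have h20 : 0 < h / 2 by rewrite divr_gt0.
have hE : h = h / 2 + h / 2 by rewrite -splitr.
have [e1 [ce1 he1]] := IH a c _ h20.
have [e2 [ce2 he2]] := IH (a + h / 2) c _ h20.
have [e3 [ce3 he3]] := IH a (c + h / 2) _ h20.
have [e4 [ce4 he4]] := IH (a + h / 2) (c + h / 2) _ h20.
exists (fun n => (e1 n + e2 n) + (e3 n + e4 n)); split.
  have z : (0 + 0) + (0 + 0) = 0 :> R by rewrite !addr0.
  by rewrite -[X in _ --> X]z; apply: cvgD; apply: cvgD.
move=> n.
have coef : 2 * (h * 2^-1 ^+ j.+1) ^+ 2 = 2 * (h / 2 * 2^-1 ^+ j) ^+ 2.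
  by congr (2 * _ ^+ 2); rewrite exprS; field.
rewrite coef (_ : square a c h = square a c (h / 2 + h / 2)); last by rewrite -hE.
have K0 : 0 <= 2 * (h / 2 * 2^-1 ^+ j) ^+ 2 by rewrite mulr_ge0// sqr_ge0.
have mf := measurable_test_sqr n; have mg := measurable_test_grad2 n.
have f20 x : 0 <= f n x ^+ 2 by exact: sqr_ge0.
have gn0 x : 0 <= grad2 n x by rewrite addr_ge0 ?sqr_ge0.
rewrite !integral_squareD//.
have g0 A : (0 <= \int[lambda2]_(x in A) (grad2 n x)%:E)%E.
  by apply: integral_ge0 => x _; rewrite lee_fin.
rewrite ge0_muleDr ?(adde_ge0 (g0 _) (g0 _))//.
rewrite (ge0_muleDr _ (g0 _) (g0 _)) (ge0_muleDr _ (g0 _) (g0 _)) !EFinD.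
apply: le_trans (leeD (leeD (he1 n) (he2 n)) (leeD (he3 n) (he4 n))) _.
by rewrite [X in (X + _ <= _)%E]addeACA [X in (_ + X <= _)%E]addeACA [leLHS]addeACA.
Qed.

(** Three shares of e / 3. Outside the square V > 3 B' / e, so int f^2 is at most e / (3 B') times
    the norm. Inside it, j is fixed first to control the gradient term, and then n is taken large to
    control the means. *)
Lemma vanishing_means_L2 (V : R * R -> R) (B : R) : continuous V ->
  (forall x, 0 < V x) ->
  (forall M : R, exists r : R, forall x, r < eucl x -> M < V x) ->
  (forall n, (normV2 V (hv_of (f n)) <= B%:E)%E) ->
  forall e : R, 0 < e -> exists N, forall n, (N <= n)%N ->
    (\int[lambda2]_x (f n x ^+ 2)%:E <= e%:E)%E.
Proof.
move=> Vc V0 Vcoer fB e e0.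
have V0' x : 0 <= V x by exact: ltW.
have mV : measurable_fun setT V by exact: continuous_measurable_plane.
pose B' := `|B| + 1.
have B'0 : 0 < B' by rewrite ltr_wpDl.
have fB' n : (normV2 V (hv_of (f n)) <= B'%:E)%E.
  by apply: le_trans (fB n) _; rewrite lee_fin (le_trans (ler_norm _))// lerDl.
have [r hr] := Vcoer (3 * B' / e).
pose rho := `|r| + 1; pose h := rho + rho; pose q := square (- rho) (- rho) h.
have rho0 : 0 < rho by rewrite ltr_wpDl.
have h0 : 0 < h by rewrite addr_gt0.
have out x : ~ q x -> 3 * B' / e < V x.
  move=> nq; apply: hr; have rr : r < rho by rewrite (le_lt_trans (ler_norm _))// ltrDl.
  apply: (lt_le_trans rr).
  have [x1|x1] := leP rho `|x.1|.
    apply: le_trans x1 _; rewrite /eucl -sqrtr_sqr ler_wsqrtr//.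
    by rewrite lerDl sqr_ge0.
  have [x2|x2] := leP rho `|x.2|.
    apply: le_trans x2 _; rewrite /eucl -sqrtr_sqr ler_wsqrtr//.
    by rewrite lerDr sqr_ge0.
  exfalso; apply: nq; move: x1 x2; rewrite !ltr_norml => /andP[? ?] /andP[? ?].
  by split; rewrite /= in_itv/=; apply/andP; split; rewrite /h; lra.
have [j hj] : exists j : nat, 2 * (h * 2^-1 ^+ j) ^+ 2 * B' <= e / 3.
  have c : 2 * (h * 2^-1 ^+ j) ^+ 2 * B' @[j --> \oo] --> 2 * (h * 0 * (h * 0)) * B'.
    have g : h * 2^-1 ^+ j @[j --> \oo] --> h * (0 : R).
      by apply: cvgMr; apply: cvg_expr; rewrite ger0_norm ?invr_ge0// invf_lt1 ?ltr1n.
    by apply: cvgMl; apply: cvgMr; exact: (cvgM g g).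
  have e3 : 0 < e / 3 by rewrite divr_gt0.
  rewrite !mulr0 mul0r in c; have /cvgrPdist_lt/(_ _ e3)[N _ hN] := c.
  exists N; have := hN N (leqnn N); rewrite /= sub0r normrN => /ltW.
  exact/le_trans/ler_norm.
have [eps [ceps heps]] := square_sqr_integral_le j (- rho) (- rho) h0.
have e3 : 0 < e / 3 by rewrite divr_gt0.
have /cvgrPdist_lt/(_ _ e3)[N _ hN] := ceps.
exists N => n Nn.
have epsn : eps n <= e / 3.
  by have := hN n Nn; rewrite /= sub0r normrN => /ltW; exact/le_trans/ler_norm.
have mq : measurable q by exact: measurable_square.
have md := measurable_hv_density Vc (hv_of_meas (tf n)) (hv_of_meas (tf n)).
have mi : measurable_fun setT (\1_q : R * R -> R) by exact: measurable_indic.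
have mfn := measurable_test_sqr n.
have K0 : 0 <= e / (3 * B') by rewrite divr_ge0 ?mulr_ge0// ltW.
apply: (@le_trans _ _ (1%:E * \int[lambda2]_x (f n x ^+ 2 * \1_q x)%:E
    + (e / (3 * B'))%:E * normV2 V (hv_of (f n)))%E).
  rewrite normV2E; apply: ge0_integral_le_comb => //.
  - exact: measurable_funM.
  - by move=> x _; rewrite sqr_ge0.
  - by move=> x _; rewrite mulr_ge0 ?sqr_ge0.
  - by move=> x _; exact: hv_density_ge0.
  - move=> x _; rewrite mul1r indicE; case: (boolP (x \in q)) => xq.
      by rewrite mulr1 lerDl mulr_ge0// hv_density_ge0.
    rewrite mulr0 add0r /hv_density/= -!expr2.
    have Vx : 3 * B' / e <= V x by apply/ltW/out => qx; rewrite mem_set in xq.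
    apply: (@le_trans _ _ (e / (3 * B') * (3 * B' / e * f n x ^+ 2))).
      by rewrite mulrA (_ : e / (3 * B') * (3 * B' / e) = 1) ?mul1r//; field;
        rewrite !gt_eqF.
    rewrite ler_wpM2l//; apply: (@le_trans _ _ (V x * f n x ^+ 2)).
      by rewrite ler_wpM2r// sqr_ge0.
    by rewrite lerDr addr_ge0 ?sqr_ge0.
have -> : e%:E = ((e / 3 + e / 3)%:E + (e / (3 * B') * B')%:E)%E.
  by rewrite -EFinD; congr (_%:E); field; rewrite gt_eqF.
apply: leeD; last by rewrite [leRHS]EFinM lee_wpmul2l.
rewrite mul1e.
have -> : (\int[lambda2]_x (f n x ^+ 2 * \1_q x)%:E
    = \int[lambda2]_(x in q) (f n x ^+ 2)%:E)%E.
  rewrite [RHS]integral_mkcond; apply: eq_integral => x _.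
  by rewrite patchE indicE; case: ifPn => _; rewrite ?mulr1 ?mulr0.
apply: le_trans (heps n) _; rewrite EFinD; apply: leeD; first by rewrite lee_fin.
apply: (@le_trans _ _ ((2 * (h * 2^-1 ^+ j) ^+ 2)%:E * B'%:E)%E); last first.
  by rewrite -EFinM lee_fin.
apply: lee_wpmul2l; first by rewrite lee_fin mulr_ge0// sqr_ge0.
apply: le_trans (fB' n); rewrite normV2E.
have mg := measurable_test_grad2 n.
have gE0 x : 0 <= grad2 n x by rewrite addr_ge0 ?sqr_ge0.
have mgE : measurable_fun setT (fun x => (grad2 n x)%:E) by exact/measurable_EFinP.
have mdE : measurable_fun setT
    (fun x => (hv_density V (hv_of (f n)) (hv_of (f n)) x)%:E).
  exact/measurable_EFinP.
apply: (@le_trans _ _ (\int[lambda2]_x (grad2 n x)%:E)%E).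
  by apply: ge0_subset_integral => // x _; rewrite lee_fin.
apply: ge0_le_integral => //; first by move=> x _; rewrite lee_fin.
move=> x _; rewrite lee_fin /hv_density/= -!expr2 lerDl mulr_ge0// sqr_ge0//.
Qed.

End vanishing_means.
End rellich.

(** * Coercivity and means over squares *)

Section compact_embedding.
Context (R : realType) (V : R * R -> R).
Hypothesis Vc : continuous V.
Hypothesis V0 : forall x, 0 < V x.
Hypothesis Vcoer : forall M : R, exists r : R, forall x, r < eucl x -> M < V x.
Local Notation lambda2 := (@leb2 R).
Implicit Types (w : hv R) (a c h v : R).

(** Coercivity gives V > 1 outside a square, and the continuous function 1 / V is bounded on that
    compact square. This constant controls the L^2 norm by the norm of the space. *)
Lemma coercive_lower_bound : exists v0, 0 < v0 /\ forall x, v0 <= V x.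
Proof.
have [r hr] := Vcoer 1.
pose rho := `|r| + 1.
pose K : set (R * R) := `[- rho, rho]%classic `*` `[- rho, rho]%classic.
have cK : compact K by apply: compact_setX; exact: segment_compact.
have cVi : continuous (fun x => (V x)^-1).
  by move=> x; apply: cvgV; [rewrite gt_eqF|exact: Vc].
have [M [_ hM]] : bounded_set ((fun x => (V x)^-1) @` K).
  by apply/compact_bounded/continuous_compact => //; exact: continuous_subspaceT.
have M1 : 0 < `|M| + 1 by rewrite ltr_wpDl.
exists (Num.min 1 (`|M| + 1)^-1); split; first by rewrite lt_min ltr01 invr_gt0.
move=> x; rewrite ge_min; case: (pselect (K x)) => [Kx|nKx].
  apply/orP; right; rewrite -[V x]invrK lef_pV2 ?posrE ?invr_gt0//.
  apply: le_trans (ler_norm _) (hM _ _ _ _); last by exists x.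
  by rewrite (le_lt_trans (ler_norm _))// ltrDl.
apply/orP; left; apply/ltW/hr.
have rr : r < rho by rewrite (le_lt_trans (ler_norm _))// ltrDl.
apply: (lt_le_trans rr).
have [x1|x1] := leP rho `|x.1|.
  apply: le_trans x1 _; rewrite /eucl -sqrtr_sqr ler_wsqrtr//.
  by rewrite lerDl sqr_ge0.
have [x2|x2] := leP rho `|x.2|.
  apply: le_trans x2 _; rewrite /eucl -sqrtr_sqr ler_wsqrtr//.
  by rewrite lerDr sqr_ge0.
exfalso; apply: nKx; move: x1 x2; rewrite !ltr_norml => /andP[? ?] /andP[? ?].
by split; rewrite /= in_itv/=; apply/andP; split; exact: ltW.
Qed.

Lemma L2norm2_le v0 w : 0 < v0 -> (forall x, v0 <= V x) -> hv_meas w ->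
  (L2norm2 w <= v0^-1%:E * normV2 V w)%E.
Proof.
move=> v00 v0V mw; have md := measurable_hv_density Vc mw mw.
have mu : measurable_fun setT (hv_u w) by case: mw.
rewrite normV2E -[leRHS]adde0.
rewrite -[X in (_ + X)%E](mul0e (\int[lambda2]_x (hv_density V w w x)%:E)).
apply: ge0_integral_le_comb => //; try by move=> x _; exact: hv_density_ge0.
- by rewrite invr_ge0 ltW.
- exact: measurable_funX.
- by move=> x _; exact: sqr_ge0.
- move=> x _; rewrite mul0r addr0 ler_pdivlMl// /hv_density -!expr2.
  apply: (@le_trans _ _ (V x * hv_u w x ^+ 2)); first by rewrite ler_wpM2r// sqr_ge0.
  by rewrite lerDr addr_ge0 ?sqr_ge0.
Qed.

(** The integral itself, not divided by the area h^2. *)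
Definition square_mean a c h w : R := (\int[lambda2]_(x in square a c h) hv_u w x)%R.

Lemma square_hv_integrable a c h w : 0 < h -> in_HV V w ->
  lambda2.-integrable (square a c h) (EFin \o hv_u w) /\
  lambda2.-integrable (square a c h) (EFin \o (fun x => hv_u w x ^+ 2)).
Proof.
move=> h0 Hw; have [v0 [v00 v0V]] := coercive_lower_bound.
have mw := in_HV_meas V0 Hw.
have mu : measurable_fun setT (hv_u w) by case: mw.
have mq := measurable_square a c h.
have mu2 : measurable_fun setT (fun x => hv_u w x ^+ 2) by exact: measurable_funX.
have i2 : lambda2.-integrable (square a c h) (EFin \o (fun x => hv_u w x ^+ 2)).
  apply: (@integrableS _ _ _ _ setT) => //; apply/integrableP; split.
    exact/measurable_EFinP.
  under eq_integral do rewrite gee0_abs ?lee_fin ?sqr_ge0//.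
  apply: le_lt_trans (L2norm2_le v00 v0V mw) _.
  by rewrite lte_mul_pinfty ?lee_fin ?invr_ge0 ?(ltW v00)// (in_HV_lty Vc V0).
have i1 : lambda2.-integrable (square a c h) (EFin \o (fun _ : R * R => 1 : R)).
  apply/integrableP; split; first exact/measurable_EFinP/measurable_cst.
  rewrite /= integral_cst//.
  by rewrite [X in (_ * X)%E](_ : _ = (h ^+ 2)%:E) ?ltry//; exact: leb2_square.
split => //.
have i21 : lambda2.-integrable (square a c h) (EFin \o (fun x => hv_u w x ^+ 2 + 1)).
  exact: integrableD i2 i1.
apply: le_integrable i21 => //.
  by apply/measurable_EFinP; exact: measurable_funTS.
move=> x _; rewrite lee_fin [leRHS]ger0_norm; last by rewrite addr_ge0 ?sqr_ge0.
rewrite /= ler_norml; apply/andP; split;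
  have := sqr_ge0 (hv_u w x - 1); have := sqr_ge0 (hv_u w x + 1); nra.
Qed.

(** These are the functionals on which weak convergence is tested. By Cauchy-Schwarz the squared
    integral is at most h^2 int u^2 <= (h^2 / v0) normV2, whence the constant h * sqrt (1 / v0). *)
Lemma square_mean_cont_lin a c h : 0 < h ->
  cont_lin_functional V (square_mean a c h).
Proof.
move=> h0; have [v0 [v00 v0V]] := coercive_lower_bound.
have mq := measurable_square a c h.
split.
  move=> w1 w2 k H1 H2; rewrite /square_mean/=.
  have [i1 _] := square_hv_integrable a c h0 H1.
  have [i2 _] := square_hv_integrable a c h0 H2.
  rewrite -RintegralZl// -RintegralD//.
  exact: (@integrableZl _ _ _ _ _ _ k _ i1).
exists (h * Num.sqrt v0^-1) => w Hw.
have [i1 i2] := square_hv_integrable a c h0 Hw.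
rewrite (normV_inner Vc V0 Hw).
have cs : square_mean a c h w ^+ 2 <=
    (\int[lambda2]_(x in square a c h) (hv_u w x ^+ 2))%R * h ^+ 2.
  apply: sqr_le_discriminant => [|t].
    by apply: Rintegral_ge0 => x _; exact: sqr_ge0.
  have := square_quadratic_integral (t ^+ 2) (2 * t) 1 h0 i1 i2.
  rewrite mul1r -lee_fin => <-; apply: integral_ge0 => x _; rewrite lee_fin.
  rewrite (_ : _ + 1 = (t * hv_u w x + 1) ^+ 2) ?sqr_ge0//; ring.
have S_le : (\int[lambda2]_(x in square a c h) (hv_u w x ^+ 2))%R
    <= v0^-1 * hv_inner V w w.
  rewrite -lee_fin EFinM -(normV2_inner Vc V0 Hw).
  apply: le_trans (L2norm2_le v00 v0V (in_HV_meas V0 Hw)).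
  rewrite /Rintegral fineK; last exact: integrable_fin_num i2.
  apply: ge0_subset_integral => //.
    apply/measurable_EFinP; apply: measurable_funX.
    by case: (in_HV_meas V0 Hw).
  by move=> x _; rewrite lee_fin sqr_ge0.
have B0 : 0 <= hv_inner V w w by exact: (semi_inner_ge0 (semi_inner_HV Vc V0)).
have -> : h * Num.sqrt v0^-1 * Num.sqrt (hv_inner V w w)
    = Num.sqrt (h ^+ 2 * (v0^-1 * hv_inner V w w)).
  rewrite (sqrtrM _ (sqr_ge0 h)) sqrtr_sqr (ger0_norm (ltW h0)).
  by rewrite sqrtrM ?invr_ge0 ?(ltW v00)// mulrA.
rewrite -sqrtr_sqr ler_wsqrtr//; apply: le_trans cs _.
by rewrite mulrC ler_wpM2l// sqr_ge0.
Qed.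

(* Replacing [u n] by a nearby test function, to which the Poincare inequality
   applies. *)
Lemma weakly_null_L2 (u : nat -> hv R) (M : R) : (forall n, in_HV V (u n)) ->
  (forall n, (normV2 V (u n) <= M%:E)%E) ->
  (forall a c h, 0 < h -> square_mean a c h (u n) @[n --> \oo] --> (0 : R)) ->
  forall e : R, 0 < e -> exists n, (L2norm2 (u n) <= e%:E)%E.
Proof.
move=> Hu uM umean e e0.
have [v0 [v00 v0V]] := coercive_lower_bound.
have mun n := in_HV_meas V0 (Hu n).
have d0 n : 0 < n.+1%:R^-1 :> R by rewrite invr_gt0.
have happ n : exists f, test_fun f /\
    (normV2 V (hv_of f - u n)%R <= (n.+1%:R^-1)%:E)%E.
  by have /(in_HVP V0)[_] := Hu n; apply.
have [f hf] := choice happ.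
have tf n := (hf n).1; have fu n := (hf n).2.
have mf n := hv_of_meas (tf n).
have Hfu n : in_HV V (hv_of (f n) - u n).
  apply: submodule_sub => //; first by case: (semi_inner_HV Vc V0).
  exact: (in_HV_test V0).
have fB n : (normV2 V (hv_of (f n)) <= (2 * 1 + 2 * M)%:E)%E.
  have -> : hv_of (f n) = 1 *: (hv_of (f n) - u n) + u n by rewrite scale1r subrK.
  apply: le_trans (normV2_lin_le Vc V0 1 (hv_measB (mf n) (mun n)) (mun n)) _.
  have -> : (2 * 1 + 2 * M)%:E = (2%:E * 1%:E + 2%:E * M%:E)%E by [].
  rewrite expr1n mulr1; apply: leeD; apply: lee_wpmul2l => //.
  by apply: le_trans (fu n) _; rewrite lee_fin invf_le1 ?ler1n.
(* The means of [f n] inherit the limit 0, since [square_mean] is continuous and hv_of (f n) - u n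
   tends to 0 in norm. *)
have fmean a c h : 0 < h ->
    (\int[lambda2]_(x in square a c h) f n x)%R @[n --> \oo] --> (0 : R).
  move=> h0; have [mlin [K hK]] := square_mean_cont_lin a c h0.
  have dE n : (\int[lambda2]_(x in square a c h) f n x)%R
      = square_mean a c h (hv_of (f n) - u n) + square_mean a c h (u n).
    have := mlin _ _ 1 (Hfu n) (Hu n); rewrite mul1r => <-.
    by rewrite -[hv_add _ _]/(1 *: (hv_of (f n) - u n) + u n) scale1r subrK.
  rewrite (_ : (fun n => (\int[lambda2]_(x in square a c h) f n x)%R) = (fun n =>
    square_mean a c h (hv_of (f n) - u n) + square_mean a c h (u n))); last exact/funext.
  rewrite -[X in _ --> X](add0r (0 : R)); apply: cvgD; last exact: umean.
  apply/norm_cvg0P.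
  apply: (@squeeze_cvgr _ _ _ _ (fun=> 0) (fun n => `|K| * Num.sqrt n.+1%:R^-1)).
  - apply: nearW => n; rewrite normr_ge0/=.
    apply: le_trans (hK _ (Hfu n)) _.
    apply: (@le_trans _ _ (`|K| * normV V (hv_of (f n) - u n))).
      by rewrite ler_wpM2r ?sqrtr_ge0// ler_norm.
    rewrite ler_wpM2l// (normV_inner Vc V0 (Hfu n)) ler_wsqrtr//.
    by rewrite -lee_fin -(normV2_inner Vc V0 (Hfu n)).
  - exact: cvg_cst.
  - have z : `|K| * Num.sqrt 0 = 0 :> R by rewrite sqrtr0 mulr0.
    rewrite -[X in _ --> X]z; apply: cvgMr; apply: (continuous_cvg _ (@sqrt_continuous R _)).
    exact: cvg_harmonic.
have e4 : 0 < e / 4 by rewrite divr_gt0.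
have [N hN] := vanishing_means_L2 tf fmean Vc V0 Vcoer fB e4.
(* Precision v0 * e / 4 in [normV2] becomes e / 4 in [L2norm2], through the factor 1 / v0 of
   [L2norm2_le]. *)
have ve : 0 < v0 * (e / 4) by rewrite mulr_gt0.
have /cvgrPdist_lt/(_ _ ve)[N' _ hN'] := @cvg_harmonic R.
pose n := maxn N N'; exists n.
have nN' : n.+1%:R^-1 <= v0 * (e / 4).
  have := hN' n (leq_maxr _ _); rewrite /= sub0r normrN => /ltW.
  exact/le_trans/ler_norm.
have mfn : measurable_fun setT (f n) by case: (mf n).
have mu : measurable_fun setT (hv_u (u n)) by case: (mun n).
apply: (@le_trans _ _ (2%:E * \int[lambda2]_x (f n x ^+ 2)%:E
    + 2%:E * L2norm2 (hv_of (f n) - u n)%R)%E).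
  apply: ge0_integral_le_comb => //.
  - exact: measurable_funX.
  - exact: measurable_funX.
  - by apply: measurable_funX; case: (hv_measB (mf n) (mun n)).
  - by move=> x _; exact: sqr_ge0.
  - by move=> x _; exact: sqr_ge0.
  - by move=> x _; exact: sqr_ge0.
  - move=> x _; rewrite hv_uB/=.
    have := sqr_ge0 (f n x + (f n x - hv_u (u n) x)); nra.
rewrite (four_quarters e); apply: leeD; apply: lee_wpmul2l => //.
  by apply: hN; rewrite leq_maxl.
apply: le_trans (L2norm2_le v00 v0V (hv_measB (mf n) (mun n))) _.
apply: (@le_trans _ _ (v0^-1%:E * (v0 * (e / 4))%:E)%E).
  apply: lee_wpmul2l; first by rewrite lee_fin invr_ge0 ltW.
  by apply: le_trans (fu n) _; rewrite lee_fin.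
by rewrite -EFinM mulKf ?gt_eqF.
Qed.

End compact_embedding.

(** * The constraint set and minimising sequences *)

Section nehari.
Context (R : realType) (V : R * R -> R) (p : R).
Hypothesis Vc : continuous V.
Hypothesis V0 : forall x, 0 < V x.
Hypothesis Vcoer : forall M : R, exists r : R, forall x, r < eucl x -> M < V x.
Hypothesis p0 : 0 < p.
Implicit Types w : hv R.

Lemma L2norm2_ge0 w : (0 <= L2norm2 w)%E.
Proof. by apply: integral_ge0 => x _; rewrite lee_fin sqr_ge0. Qed.

Lemma L2norm2_eq0 w : hv_meas w -> L2norm2 w = 0%E -> hv_is_zero w.
Proof.
move=> [mu _ _] w0.
have mu2 : measurable_fun setT (fun x => (hv_u w x ^+ 2)%:E).
  by apply/measurable_EFinP; exact: measurable_funX.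
have : ae_eq (@leb2 R) setT (fun x => (hv_u w x ^+ 2)%:E) (cst 0%E).
  apply/(ae_eq_integral_abs (@leb2 R) measurableT mu2).
  rewrite -w0; apply: eq_integral => x _.
  by rewrite gee0_abs// lee_fin sqr_ge0.
by apply: ae_leb2S => x /(_ I) [] /eqP; rewrite sqrf_eq0 => /eqP.
Qed.

Lemma L2norm2_gt0 w : hv_meas w -> ~ hv_is_zero w -> (0 < L2norm2 w)%E.
Proof.
move=> mw nw; rewrite lt_neqAle L2norm2_ge0 andbT eq_sym; apply/eqP => w0.
exact/nw/L2norm2_eq0.
Qed.

Lemma L2norm2_fin w : in_HV V w -> L2norm2 w \is a fin_num.
Proof.
move=> Hw; rewrite ge0_fin_numE ?L2norm2_ge0//.
have [v0 [v00 v0V]] := coercive_lower_bound Vc V0 Vcoer.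
apply: le_lt_trans (L2norm2_le Vc V0 v00 v0V (in_HV_meas V0 Hw)) _.
apply: lte_mul_pinfty => //; first by rewrite lee_fin invr_ge0 ltW.
exact: (in_HV_lty Vc V0).
Qed.

Lemma normV2_gt0 w : in_HV V w -> ~ hv_is_zero w -> (0 < normV2 V w)%E.
Proof.
move=> Hw nw; rewrite lt_neqAle normV2_ge0// andbT eq_sym; apply/eqP => w0.
have [v0 [v00 v0V]] := coercive_lower_bound Vc V0 Vcoer.
have := L2norm2_le Vc V0 v00 v0V (in_HV_meas V0 Hw).
by rewrite w0 mule0 leNgt L2norm2_gt0//; exact: in_HV_meas Hw.
Qed.

Lemma Vpow_ge0 w : (0 <= Vpow V p w)%E.
Proof. by apply: integral_ge0 => x _; rewrite lee_fin mulr_ge0 ?powR_ge0// ltW. Qed.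

(** The constraint equates a positive multiple of L2norm2 * Vpow with the finite number N, so this
    product is finite and can be eliminated from the functional. *)
Lemma Ifun_Nset w : Nset V p w ->
  Ifun V p w = ((p + 1) / (2 * (p + 3)) * hv_inner V w w)%:E.
Proof.
move=> [Hw [nw]]; rewrite /Ifun (normV2_inner Vc V0 Hw).
have := mule_ge0 (L2norm2_ge0 w) (Vpow_ge0 w).
have p1 : p + 1 != 0 by rewrite gt_eqF// addr_gt0.
have p3 : p + 3 != 0 by rewrite gt_eqF// addr_gt0.
case: (L2norm2 w * Vpow V p w)%E => [q q0|_|//].
  rewrite -!EFinM => -[NE]; rewrite -EFinB; congr (_%:E).
  by rewrite NE; field; rewrite p1 p3.
by rewrite gt0_muley// lte_fin divr_gt0// addr_gt0.
Qed.

(** Dividing N <= k l A N by N > 0 leaves 1 <= k A l. The added 1 keeps the inverted number positive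
    even for A = 0. *)
Lemma Nset_L2norm2_ge w (A : R) : 0 <= A -> Nset V p w ->
  (Vpow V p w <= A%:E * normV2 V w)%E ->
  (((p + 3) / (p + 1) * A + 1)^-1%:E <= L2norm2 w)%E.
Proof.
move=> A0 [Hw [nw]]; have := normV2_gt0 Hw nw; have fin := L2norm2_fin Hw.
rewrite (normV2_inner Vc V0 Hw) lte_fin -(fineK fin).
set N := hv_inner V w w; set l := fine (L2norm2 w) => N0 NE VA.
have l0 : 0 <= l by rewrite fine_ge0// L2norm2_ge0.
set k := (p + 3) / (p + 1) in NE *.
have k0 : 0 <= k by rewrite divr_ge0// ltW// addr_gt0.
have : (N%:E <= k%:E * (l%:E * (A%:E * N%:E)))%E.
  by rewrite {1}NE; do 2 (apply: lee_wpmul2l; first by rewrite lee_fin).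
rewrite -!EFinM !lee_fin => h.
have h1 : 1 <= k * A * l.
  rewrite -(ler_pM2r N0) mul1r; apply: le_trans h _.
  by rewrite le_eqVlt; apply/orP; left; apply/eqP; ring.
have kA : 0 < k * A + 1 by rewrite ltr_wpDl// mulr_ge0.
rewrite -(ler_pM2l kA) mulfV ?gt_eqF//.
by rewrite (le_trans h1)// ler_wpM2r// lerDl.
Qed.

End nehari.

(** The infimum is finite: the functional is nonnegative on the constraint set and finite at [u 0].
    Hence k N converges as a real sequence, and a convergent sequence is bounded. *)
Lemma minimizing_seq_bounded (R : realType) (V : R * R -> R) (p : R)
    (u : nat -> hv R) :
  continuous V -> (forall x, 0 < V x) -> 0 < p -> (forall n, Nset V p (u n)) ->
  (Ifun V p (u n) @[n --> \oo] --> sigma V p)%E ->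
  exists M : R, 0 <= M /\ forall n, (normV2 V (u n) <= M%:E)%E.
Proof.
move=> Vc V0 p0 uN Iu.
have Hu n : in_HV V (u n) by case: (uN n).
set k : R := (p + 1) / (2 * (p + 3)).
have k0 : 0 < k by rewrite divr_gt0 ?mulr_gt0// addr_gt0.
have inner_ge0 w : in_HV V w -> 0 <= hv_inner V w w.
  exact: (semi_inner_ge0 (semi_inner_HV Vc V0)).
have sfin : sigma V p \is a fin_num.
  rewrite ge0_fin_numE.
    apply: (@le_lt_trans _ _ (Ifun V p (u 0%N))).
      by apply: ereal_inf_lbound; exists (u 0%N).
    by rewrite (Ifun_Nset Vc V0 p0 (uN 0%N)) ltry.
  apply: le_ereal_inf_tmp => _ [w Nw <-].
  rewrite (Ifun_Nset Vc V0 p0 Nw) lee_fin mulr_ge0 ?(ltW k0)// inner_ge0//.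
  by case: Nw.
have cI : k * hv_inner V (u n) (u n) @[n --> \oo] --> fine (sigma V p).
  move: Iu; rewrite -(fineK sfin) => /fine_cvgP[_].
  rewrite (_ : fine \o _ = (fun n => k * hv_inner V (u n) (u n)))//.
  by apply/funext => n /=; rewrite (Ifun_Nset Vc V0 p0 (uN n)).
have [M [_ hM]] := cvg_seq_bounded (cvgP _ cI).
exists ((`|M| + 1) / k); split; first by rewrite divr_ge0 ?addr_ge0// ltW.
move=> n; rewrite (normV2_inner Vc V0 (Hu n)) lee_fin ler_pdivlMr// mulrC.
apply: le_trans (ler_norm _) (hM _ _ n I).
by rewrite (le_lt_trans (ler_norm _))// ltrDl.
Qed.

Theorem lemma3p5 (R : realType) (p : R) (V : R * R -> R) (C : R)
  (hp : 1 < p)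
  (hV1 : C1 V)
  (hVpos : forall x, 0 < V x)
  (hVcoer : forall M : R, exists r : R, forall x, r < eucl x -> M < V x)
  (hC : 0 < C)
  (hgrad : {ae @leb2 R, forall x, gradnorm V x <= C * powR (V x) (3 / 2)})
  (u : nat -> hv R)
  (huN : forall n, Nset V p (u n))
  (hIu : (Ifun V p (u n) @[n --> \oo] --> sigma V p)%E) :
  exists phi : nat -> nat, {homo phi : m n / (m < n)%N >-> (m < n)%N} /\
  exists u0 : hv R, in_HV V u0 /\ ~ hv_is_zero u0 /\
    weak_cvg V (fun n => u (phi n)) u0.
Proof.
have Vc : continuous V by exact: C1_continuous.
have p0 : 0 < p by exact: lt_trans hp.
have [M [M0 uM]] := minimizing_seq_bounded Vc hVpos p0 huN hIu.
have Hu n : in_HV V (u n) by case: (huN n).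
have B_inner := semi_inner_HV Vc hVpos.
have B_complete := complete_HV Vc hVpos.
have uM' n : hv_inner V (u n) (u n) <= M.
  by rewrite -lee_fin -(normV2_inner Vc hVpos (Hu n)).
have [phi [phi_incr [u0 [Hu0 uu0]]]] :=
  weak_sequential_compactness B_inner B_complete Hu uM'.
have wcvg : weak_cvg V (fun n => u (phi n)) u0.
  move=> L [Llin [K LK]].
  have HVsub : submodule (in_HV V : set (hv R)) by case: B_inner.
  have Llin' : linear_on (in_HV V : set (hv R)) L.
    by move=> k a b Ha Hb; exact: Llin.
  have LK' (a : hv R) : in_HV V a -> `|L a| <= K * Num.sqrt (hv_inner V a a).
    by move=> Ha; rewrite -(normV_inner Vc hVpos Ha); exact: LK.
  (* Riesz on the whole space writes L as the product with some [v], for which convergence is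
     already known. *)
  have [v [Hv Lv]] := riesz_representation B_inner (fun _ => id) HVsub B_complete
    Llin' LK'.
  rewrite Lv//; under eq_cvg do rewrite Lv//.
  exact: uu0.
exists phi; split => //; exists u0; split => //; split => // u00.
have [A [A0 hA]] := Vpow_le hV1 hVpos hC hgrad M0 (ltW hp).
(* The uniform lower bound for the squared L^2 norms, to be contradicted by some term with value at
   most d / 2. *)
pose d : R := ((p + 3) / (p + 1) * A + 1)^-1.
have d0 : 0 < d.
  by rewrite invr_gt0 ltr_wpDl// mulr_ge0// divr_ge0// addr_ge0// ltW.
have ud n : (d%:E <= L2norm2 (u n))%E.
  have [Hw [nw _]] := huN n.
  apply: (Nset_L2norm2_ge Vc hVpos hVcoer p0 A0 (huN n)).
  by apply: hA => //; exact: (normV2_gt0 Vc hVpos hVcoer).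
have d2 : 0 < d / 2 by rewrite divr_gt0.
have umean a c h : 0 < h ->
    square_mean a c h (u (phi n)) @[n --> \oo] --> (0 : R).
  move=> h0.
  (* [hv_is_zero] concerns only the function component of [u0], which is also the only one that the
     means see. *)
  have -> : 0 = square_mean a c h u0.
    apply/esym; rewrite /square_mean /Rintegral.
    rewrite (@ae_eq_integral _ _ _ (@leb2 R) _ (cst 0%E)) ?integral0//.
    - exact: measurable_square.
    - by apply/measurable_EFinP; apply: measurable_funTS; case: Hu0.
    - by apply: ae_leb2S u00 => x ->.
  exact: (wcvg _ (square_mean_cont_lin Vc hVpos hVcoer a c h0)).
have [n hn] := weakly_null_L2 Vc hVpos hVcoer (fun n => Hu (phi n))
  (fun n => uM (phi n)) umean d2.
have := le_trans (ud (phi n)) hn.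
by rewrite lee_fin leNgt ltr_pdivrMr// ltr_pMr// ltr1n.
Qed.
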